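(* For every $f\in\mathcal F^{1,1}$, $$\int_{\mathbb C}\left|f(z)e^{-\frac{|z|^2}{2}}\right|^2dA(z)-\pi|f(0)|^2\le(2\pi)^{-1}\left(\int_{\mathbb C}\left|f'(z)e^{-\frac{|z|^2}{2}}\right|dA(z)\right)^2.$$
   Context: $dA$ is the Euclidean area measure on $\mathbb C$. $\mathcal F^{1,1}$ is the Fock-Sobolev space of all entire functions $f:\mathbb C\to\mathbb C$ with $\int_{\mathbb C}|z f(z)|e^{-|z|^2/2}\,dA(z)<\infty$. *)

(* Defs.v *)
From mathcomp Require Import all_boot all_order all_algebra.
From mathcomp Require Import complex.
From mathcomp Require Import all_classical all_reals all_analysis.

Set Implicit Arguments.
Unset Strict Implicit.
Unset Printing Implicit Defensive.

Import Order.TTheory GRing.Theory Num.Theory.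
Import numFieldNormedType.Exports.

Local Open Scope classical_set_scope.
Local Open Scope ring_scope.
Local Open Scope complex_scope.

(* The norm `|z| of R[i] takes its values in R[i]; this is the R-valued one. *)
Definition cabs (R : realType) (z : R[i]) : R := Normc.normc z.

(* Derivability is over the field R[i], hence in the complex sense. *)
Definition entire (R : realType) (f : R[i] -> R[i]) : Prop :=
  forall z : R[i], derivable (f : R[i]^o -> R[i]^o) z 1.

Definition cderiv (R : realType) (f : R[i] -> R[i]) : R[i] -> R[i] :=
  @derive1 R[i] R[i]^o f.

(* Integral over the complex plane with respect to the area measure dA, the
   plane being identified with R * R by (x, y) |-> x + iy. *)
Definition area_integral (R : realType) (g : R[i] -> \bar R) : \bar R :=
  (\int[(@lebesgue_measure R \x @lebesgue_measure R)%E]_p g (p.1 +i* p.2))%E.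

Definition gauss (R : realType) (z : R[i]) : R := expR (- (cabs z ^+ 2 / 2)).

Definition fock_sobolev11 (R : realType) : set (R[i] -> R[i]) :=
  [set f | entire f /\
    (area_integral (fun z => (cabs (z * f z) * gauss z)%:E) < +oo)%E].

(* Main.v *)
From HB Require Import structures.
Require Import Defs.
From mathcomp Require Import all_boot all_order all_algebra.
From mathcomp Require Import complex.
From mathcomp Require Import all_classical all_reals all_analysis.
From mathcomp Require Import measurable_realfun.
From mathcomp Require Import ring lra.

Set Implicit Arguments.
Unset Strict Implicit.
Unset Printing Implicit Defensive.

Import Order.TTheory GRing.Theory Num.Theory.
Import numFieldNormedType.Exports.

Local Open Scope ring_scope.
Local Open Scope complex_scope.
Local Open Scope classical_set_scope.

Local Notation Re := (@complex.Re _).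
Local Notation Im := (@complex.Im _).

(** Write F for f'. The inequality is the composition of two, through the
    integral of |F|^2 e^(-|z|^2) over the plane.

    The energy inequality bounds the left-hand side by this integral. On each
    circle centred at 0 the function f - f(0) has
    mean 0, so that the left-hand side is the integral of
    |f - f(0)|^2 e^(-|z|^2) (area_square_decomp). By Cauchy-Schwarz along rays,
    |f(z) - f(0)|^2 is at most |z|^2 times the mean of |F(t z)|^2 over t in
    [0, 1]. After integration in z the t-integrand is nondecreasing in t,
    because the square means of F on circles increase with the radius
    (mean_square_mono); Chebyshev's inequality then allows the weight 2 t to be
    inserted (chebyshev_unit). With this weight the dilation u = t z turns the
    double integral into that of |F(u)|^2 against the kernel
    2 |u|^2 t^(-3) e^(-|u|^2 / t^2), whose integral over t in [0, 1] is
    e^(-|u|^2) (integral_radial_kernel). For f = z^n this is the comparison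
    n! <= n * n!.

    The embedding bounds the integral of |F|^2 e^(-|z|^2) by (2 pi)^(-1) times
    the square of the integral of |F| e^(-|z|^2 / 2). Indeed
    |F(w)| e^(-|w|^2 / 2) is at most (2 pi)^(-1) times that last integral
    (fock_pointwise): this is the mean value inequality at w = 0, and Weyl
    translations carry 0 to w. One of the two factors of |F|^2 e^(-|z|^2) is
    estimated in this way.

    Holomorphy is used through Goursat's theorem for rectangles, applied to
    functions of the form h(e^w), or such functions times powers of e^w; these
    are 2 pi i - periodic, whence means over circles that do not depend on the
    radius. This gives the mean value property, Cauchy's formula for F, and
    from it the holomorphy of F. All of it is carried out on real parts, a
    modulus being recovered as a supremum of real parts of rotates.
    Polar coordinates are replaced by the invariance of the area under
    rotations: integrating over the plane the integral over the circle through
    z multiplies by 2 pi (area_circle_average). *)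

(** * Complex numbers through their real-valued modulus *)

Section modulus.
Variable R : realType.
Implicit Types (z w c : R[i]) (x y : R).

Lemma cabsE z : `|z| = (cabs z)%:C. Proof. by []. Qed.

Lemma cabs_ge0 z : 0 <= cabs z.
Proof. by rewrite -lecR -cabsE normr_ge0. Qed.

Lemma cabs0 : cabs (0 : R[i]) = 0. Proof. exact: Normc.normc0. Qed.
Lemma cabs1 : cabs (1 : R[i]) = 1. Proof. exact: Normc.normc1. Qed.
Lemma cabsM z w : cabs (z * w) = cabs z * cabs w. Proof. exact: Normc.normcM. Qed.
Lemma cabsN z : cabs (- z) = cabs z. Proof. exact: (@normcN R). Qed.
Lemma cabsD z w : cabs (z + w) <= cabs z + cabs w.
Proof. exact: (@le_normcD R). Qed.
Lemma cabsB z w : cabs (z - w) <= cabs z + cabs w.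
Proof. by rewrite -(cabsN w) cabsD. Qed.
Lemma cabsC z w : cabs (z - w) = cabs (w - z).
Proof. by rewrite -cabsN opprB. Qed.
Lemma cabs_tri z w u : cabs (z - u) <= cabs (z - w) + cabs (w - u).
Proof. by apply: le_trans (cabsD _ _); rewrite addrA subrK. Qed.

Lemma cabs2 z : cabs z ^+ 2 = Re z ^+ 2 + Im z ^+ 2.
Proof.
by case: z => a b; rewrite /cabs /= sqr_sqrtr// addr_ge0// sqr_ge0.
Qed.

Lemma cabs_eq0 z : (cabs z == 0) = (z == 0).
Proof.
apply/eqP/eqP => [|->]; last exact: cabs0.
exact: Normc.eq0_normc.
Qed.

Lemma cabs_real x : cabs x%:C = `|x|.
Proof. by rewrite /cabs /= expr0n addr0 sqrtr_sqr. Qed.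

Lemma cabs_conj z : cabs (conjc z) = cabs z.
Proof. by case: z => a b; rewrite /cabs /= sqrrN. Qed.

Lemma cabsV z : cabs z^-1 = (cabs z)^-1. Proof. exact: Normc.normcV. Qed.

Lemma le_Re_cabs z : `|Re z| <= cabs z.
Proof. by rewrite -sqrtr_sqr; case: z => a b; rewrite ler_wsqrtr//= lerDl sqr_ge0. Qed.

Lemma le_Im_cabs z : `|Im z| <= cabs z.
Proof. by rewrite -sqrtr_sqr; case: z => a b; rewrite ler_wsqrtr//= lerDr sqr_ge0. Qed.

Lemma cabs_le_ReIm z : cabs z <= `|Re z| + `|Im z|.
Proof.
have -> : z = (Re z)%:C + 'i * (Im z)%:C by exact: complexE.
apply: le_trans (cabsD _ _) _; rewrite cabsM !cabs_real.
have -> : cabs ('i : R[i]) = 1 by rewrite /cabs /= expr0n expr1n add0r sqrtr1.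
by rewrite -complexE mul1r.
Qed.

Lemma Re_mul z w : Re (z * w) = Re z * Re w - Im z * Im w.
Proof. by case: z w => [a b] [c d]. Qed.
Lemma Im_mul z w : Im (z * w) = Re z * Im w + Im z * Re w.
Proof. by case: z w => [a b] [c d]. Qed.
Lemma Re_add z w : Re (z + w) = Re z + Re w.
Proof. by case: z w => [a b] [c d]. Qed.
Lemma Im_add z w : Im (z + w) = Im z + Im w.
Proof. by case: z w => [a b] [c d]. Qed.
Lemma Re_opp z : Re (- z) = - Re z. Proof. by case: z. Qed.
Lemma Im_opp z : Im (- z) = - Im z. Proof. by case: z. Qed.
Lemma Re_sub z w : Re (z - w) = Re z - Re w.
Proof. by rewrite Re_add Re_opp. Qed.
Lemma Im_sub z w : Im (z - w) = Im z - Im w.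
Proof. by rewrite Im_add Im_opp. Qed.

Lemma Re_mul_conj z : Re (z * conjc z) = cabs z ^+ 2.
Proof. by rewrite cabs2; case: z => a b /=; ring. Qed.

(** A suitable rotation makes any complex number a nonnegative real, so
    moduli can be estimated through real parts only. *)
Lemma unimodular_rotation z : exists2 c, cabs c = 1 & c * z = (cabs z)%:C.
Proof.
have [->|z0] := eqVneq z 0; first by exists 1; rewrite ?cabs1 // mulr0 cabs0.
have az : cabs z != 0 by rewrite cabs_eq0.
exists (conjc z / (cabs z)%:C).
  by rewrite cabsM cabsV cabs_conj cabs_real ger0_norm ?cabs_ge0 // mulfV.
have e : conjc z * z = (cabs z)%:C ^+ 2.
  rewrite mulrC -sqr_normc cabsE; exact: erefl.
have az' : (cabs z)%:C != 0 :> R[i].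
  by apply: contra az => /eqP[->].
by rewrite mulrAC e expr2 mulfK.
Qed.

Lemma cabs_le_Re z x : (forall c, cabs c = 1 -> Re (c * z) <= x) -> cabs z <= x.
Proof. by move=> h; have [c /h + cz] := unimodular_rotation z; rewrite cz. Qed.

End modulus.

(** * Complex differentiability *)

Section little_o.
Variable K : numFieldType.

Lemma is_derive_little_o (f : K^o -> K^o) (z l : K) : is_derive z 1 f l ->
  forall e : K, 0 < e -> exists2 d, 0 < d &
    forall h : K, `|h| < d -> `|f (z + h) - f z - l * h| <= e * `|h|.
Proof.
move=> [df <-] e e0.
have /cvgrPdist_le/(_ e e0) : h^-1 *: (f (h *: 1 + z) - f z) @[h --> 0^'] --> 'D_1 f z.
  exact: df.
rewrite near_withinE => -[d /= d0 hd]; exists d => // h hd'.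
have [->|h0] := eqVneq h 0.
  by rewrite addr0 subrr sub0r !normr0 !mulr0 normrN normr0.
have := hd h; rewrite /ball_ /= sub0r normrN => /(_ hd' h0).
rewrite [h *: 1]mulr1 [_ *: _]/(_ * _) => H.
rewrite -(@ler_pM2r _ `|h|^-1) ?invr_gt0 ?normr_gt0// mulfK ?normr_eq0//.
rewrite -normfV -normrM (addrC z) distrC in H *.
by move: H; rewrite mulrDl mulNr mulfK// mulrC.
Qed.

Lemma little_o_is_derive (f : K^o -> K^o) (z l : K) :
  (forall e : K, 0 < e -> exists2 d, 0 < d &
    forall h : K, `|h| < d -> `|f (z + h) - f z - l * h| <= e * `|h|) ->
  is_derive z 1 f l.
Proof.
move=> H.
have cv : h^-1 *: (f (h *: 1 + z) - f z) @[h --> 0^'] --> (l : K^o).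
  apply/cvgrPdist_le => /= e e0; have [d d0 hd] := H e e0.
  rewrite near_withinE; exists d => // h /=.
  rewrite /ball_ /= sub0r normrN => /hd hh h0.
  rewrite [h *: 1]mulr1 [_ *: _]/(_ * _).
  move: hh; rewrite -(@ler_pM2r _ `|h|^-1) ?invr_gt0 ?normr_gt0//.
  rewrite mulfK ?normr_eq0// -normfV -normrM mulrDl mulNr mulfK// distrC.
  by rewrite (addrC z) [_ / h]mulrC.
by apply: DeriveDef; [apply/cvg_ex; exists l|apply/cvg_lim].
Qed.

End little_o.

Section complex_differentiability.
Variable R : realType.
Implicit Types (f g h : R[i] -> R[i]) (z w l : R[i]).

(** Real-valued counterpart of is_derive over the complex field: the error is
    measured by the modulus, which keeps the order on the reals available. *)
Definition cdiff f z l := forall e : R, 0 < e -> exists2 d, 0 < d &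
  forall k, cabs k < d -> cabs (f (z + k) - f z - l * k) <= e * cabs k.

Definition ccont f z := forall e : R, 0 < e -> exists2 d, 0 < d &
  forall k, cabs k < d -> cabs (f (z + k) - f z) <= e.

Lemma entire_cdiff f : entire f -> forall z, cdiff f z (cderiv f z).
Proof.
move=> ef z e e0.
have df : @is_derive R[i] R[i]^o R[i]^o z 1 f (cderiv f z).
  by rewrite /cderiv derive1E; split.
have e0' : 0 < e%:C by rewrite ltcR.
have [d d0 hd] := is_derive_little_o df e0'.
have dE : d = (Re d)%:C.
  by move: d0; rewrite ltcE /= => /andP[/eqP i0 _]; case: d i0 {hd} => a b /= ->.
exists (Re d) => [|k kd]; first by rewrite -ltcR -dE.
have := hd k; rewrite dE cabsE ltcR => /(_ kd).
by rewrite !cabsE -rmorphM lecR.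
Qed.

Lemma cdiff_ccont f z l : cdiff f z l -> ccont f z.
Proof.
move=> df e e0; have [d d0 hd] := df 1 ltr01.
have m0 : 0 < 1 + cabs l by rewrite ltr_wpDr ?cabs_ge0.
exists (Num.min d (e / (1 + cabs l))) => [|k].
  by rewrite lt_min d0 divr_gt0.
rewrite lt_min => /andP[/hd kd]; rewrite ltr_pdivlMr// => ke.
have -> : f (z + k) - f z = (f (z + k) - f z - l * k) + l * k by rewrite subrK.
apply: le_trans (cabsD _ _) _; rewrite cabsM.
by apply: le_trans (ltW ke); rewrite mulrDr mulr1 mulrC lerD// mulrC// -[leRHS]mul1r.
Qed.

Lemma ccont_bounded f z : ccont f z -> exists2 d, 0 < d &
  forall k, cabs k < d -> cabs (f (z + k)) <= 1 + cabs (f z).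
Proof.
move=> /(_ 1 ltr01)[d d0 hd]; exists d => // k /hd kd.
by rewrite -[f (z + k)](subrK (f z)) (le_trans (cabsD _ _))// lerD.
Qed.

Lemma cdiff_cst z0 z : cdiff (fun=> z0) z 0.
Proof.
move=> e e0; exists 1 => // k _.
by rewrite subrr mul0r subr0 cabs0 mulr_ge0 ?cabs_ge0// ltW.
Qed.

Lemma cdiff_id z : cdiff id z 1.
Proof.
move=> e e0; exists 1 => // k _.
have -> : id (z + k) - id z - 1 * k = 0 by rewrite /=; ring.
by rewrite cabs0 mulr_ge0 ?cabs_ge0// ltW.
Qed.

Lemma cdiffD f g z l m : cdiff f z l -> cdiff g z m ->
  cdiff (fun w => f w + g w) z (l + m).
Proof.
move=> df dg e e0; have e2 : 0 < e / 2 by rewrite divr_gt0.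
have [d1 d10 h1] := df _ e2; have [d2 d20 h2] := dg _ e2.
exists (Num.min d1 d2) => [|k]; first by rewrite lt_min d10.
rewrite lt_min => /andP[/h1 k1 /h2 k2].
have -> : f (z + k) + g (z + k) - (f z + g z) - (l + m) * k =
  (f (z + k) - f z - l * k) + (g (z + k) - g z - m * k) by ring.
apply: le_trans (cabsD _ _) _.
by rewrite [e in leRHS]splitr mulrDl lerD.
Qed.

Lemma cdiffM f g z l m : cdiff f z l -> cdiff g z m ->
  cdiff (fun w => f w * g w) z (l * g z + f z * m).
Proof.
move=> df dg e e0.
pose M := 1 + cabs l + cabs (f z) + cabs (g z).
have [l0 f0 g0] := And3 (cabs_ge0 l) (cabs_ge0 (f z)) (cabs_ge0 (g z)).
have M0 : 0 < M by rewrite /M -!addrA ltr_wpDr// !addr_ge0.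
have e3 : 0 < e / 3 / M by rewrite !divr_gt0.
have [d1 d10 h1] := df _ e3; have [d2 d20 h2] := dg _ e3.
have [d3 d30 h3] := cdiff_ccont dg e3.
have [d4 d40 h4] := ccont_bounded (cdiff_ccont dg).
exists (Num.min (Num.min d1 d2) (Num.min d3 d4)) => [|k].
  by rewrite !lt_min d10 d20 d30.
rewrite !lt_min => /andP[/andP[/h1 k1 /h2 k2] /andP[/h3 k3 /h4 k4]].
have -> : f (z + k) * g (z + k) - f z * g z - (l * g z + f z * m) * k =
  (f (z + k) - f z - l * k) * g (z + k)
  + l * k * (g (z + k) - g z) + f z * (g (z + k) - g z - m * k) by ring.
have eM : forall x, x <= M -> e / 3 / M * x <= e / 3.
  by move=> x xM; rewrite -[leRHS](divfK (lt0r_neq0 M0)) ler_pM2l.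
have -> : e * cabs k = e / 3 * cabs k + e / 3 * cabs k + e / 3 * cabs k by field.
apply: le_trans (cabsD _ _) (lerD (le_trans (cabsD _ _) (lerD _ _)) _).
- rewrite cabsM (le_trans (ler_pM _ _ k1 k4)) ?cabs_ge0// mulrAC.
  by rewrite ler_wpM2r ?cabs_ge0// eM// /M; lra.
- rewrite !cabsM (le_trans (ler_wpM2l _ k3)) ?mulr_ge0 ?cabs_ge0//.
  rewrite mulrC mulrA ler_wpM2r ?cabs_ge0// eM// /M; lra.
- rewrite cabsM (le_trans (ler_wpM2l _ k2)) ?cabs_ge0//.
  rewrite mulrA [cabs _ * _]mulrC ler_wpM2r ?cabs_ge0// eM// /M; lra.
Qed.

Lemma cdiff_comp f g z l m : cdiff g z m -> cdiff f (g z) l ->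
  cdiff (fun w => f (g w)) z (l * m).
Proof.
move=> dg df e e0.
have [l0 m0] := (cabs_ge0 l, cabs_ge0 m).
pose M := 1 + cabs l + cabs m.
have M0 : 0 < M by rewrite /M; lra.
pose e2 := Num.min 1 (e / 2 / M).
have e20 : 0 < e2 by rewrite lt_min ltr01 !divr_gt0.
have [e21 e2e] : e2 <= 1 /\ e2 * M <= e / 2.
  by rewrite -ler_pdivlMr// !ge_min !lexx orbT.
have [d1 d10 h1] := df _ e20; have [d2 d20 h2] := dg _ e20.
have dM : 0 < d1 / M / 2 by rewrite !divr_gt0.
exists (Num.min d2 (d1 / M / 2)) => [|k]; first by rewrite lt_min d20.
rewrite lt_min => /andP[/h2 k2 kd1].
pose j := g (z + k) - g z.
have k0 := cabs_ge0 k.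
have jk : cabs j <= M * cabs k.
  rewrite -[j](subrK (m * k)); apply: le_trans (cabsD _ _) _.
  rewrite cabsM; apply: le_trans (lerD k2 (lexx _)) _.
  by rewrite -mulrDl ler_wpM2r// /M; lra.
have jd1 : cabs j < d1.
  apply: le_lt_trans jk _; rewrite mulrC -ltr_pdivlMr//.
  by apply: lt_le_trans kd1 _; rewrite ler_pdivrMr// ler_peMr ?ler1n// ltW// divr_gt0.
have := h1 _ jd1; rewrite [g z + j]addrC subrK => j1.
have -> : f (g (z + k)) - f (g z) - l * m * k =
  (f (g (z + k)) - f (g z) - l * j) + l * (g (z + k) - g z - m * k).
  by rewrite /j; ring.
apply: le_trans (cabsD _ _) _; rewrite cabsM.
have -> : e * cabs k = e / 2 * cabs k + e / 2 * cabs k by field.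
apply: lerD.
  apply: (le_trans j1); apply: le_trans (ler_wpM2l (ltW e20) jk) _.
  by rewrite mulrA ler_wpM2r.
apply: le_trans (ler_wpM2l l0 k2) _; rewrite mulrA ler_wpM2r//.
apply: le_trans e2e; rewrite mulrC ler_wpM2l// ?ltW// /M; lra.
Qed.

(** Conjugating both the argument and the value preserves holomorphy; this is
    the reflection used to pair two circles of different radii. *)
Lemma cdiff_conj f z l : cdiff f (conjc z) l ->
  cdiff (fun w => conjc (f (conjc w))) z (conjc l).
Proof.
move=> df e e0; have [d d0 hd] := df e e0; exists d => // k kd.
have := hd (conjc k); rewrite cabs_conj => /(_ kd).
by rewrite -cabs_conj !rmorphB rmorphM rmorphD /= conjcK.
Qed.

End complex_differentiability.

(** * The complex exponential *)

Section complex_exponential.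
Variable R : realType.
Implicit Types (z w : R[i]) (s t x : R).

Definition cis t : R[i] := cos t +i* sin t.
Definition cexp z : R[i] := (expR (Re z))%:C * cis (Im z).

Lemma cabs_cis t : cabs (cis t) = 1.
Proof.
apply/eqP; rewrite -(@eqrXn2 _ 2) ?cabs_ge0//.
by rewrite cabs2 /= cos2Dsin2 expr1n.
Qed.

Lemma cisD s t : cis (s + t) = cis s * cis t.
Proof.
rewrite /cis cosD sinD; apply/eqP; rewrite eq_complex /= eqxx /=.
by apply/eqP; ring.
Qed.

Lemma cis0 : cis 0 = 1.
Proof. by rewrite /cis cos0 sin0. Qed.

Lemma cexpD z w : cexp (z + w) = cexp z * cexp w.
Proof.
rewrite /cexp Re_add Im_add expRD cisD rmorphM; ring.
Qed.

Lemma cexp0 : cexp 0 = 1.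
Proof. by rewrite /cexp /= expR0 cis0 mulr1. Qed.

Lemma cexpE s t : cexp (s +i* t) = (expR s)%:C * cis t.
Proof. by []. Qed.

Lemma cabs_cexp z : cabs (cexp z) = expR (Re z).
Proof. by rewrite /cexp cabsM cabs_cis mulr1 cabs_real ger0_norm ?expR_ge0. Qed.

Lemma cexpN z : cexp (- z) = (cexp z)^-1.
Proof.
have e : cexp (- z) * cexp z = 1 by rewrite -cexpD addNr cexp0.
have z0 : cexp z != 0 by apply: contra_eq_neq e => ->; rewrite mulr0 eq_sym oner_neq0.
by apply: (mulIf z0); rewrite e mulVf.
Qed.

Lemma cexp_period z : cexp (z + 0 +i* (pi *+ 2)) = cexp z.
Proof.
rewrite cexpD cexpE expR0 /cis.
have -> : cos (pi *+ 2) = 1 :> R by rewrite -[pi *+ 2]add0r cosD2pi cos0.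
have -> : sin (pi *+ 2) = 0 :> R by rewrite -[pi *+ 2]add0r sinD2pi sin0.
by rewrite mulr1 mulr1.
Qed.

Lemma cdiff_cexp0 : cdiff cexp 0 (1 : R[i]).
Proof.
move=> e e0.
(* real and imaginary part of the error are sums of 3 and 4 terms e1 * r *)
have [e1 [e10 e11 e1e]] : exists e1 : R, [/\ 0 < e1, e1 <= 1 & e1 <= e / 10].
  exists (Num.min 1 (e / 10)); rewrite lt_min ltr01 divr_gt0// !ge_min !lexx.
  by rewrite orbT.
have [d1 d10 h1] := is_derive_little_o (is_derive_expR (0 : R)) e10.
have [d2 d20 h2] := is_derive_little_o (is_derive_cos (0 : R)) e10.
have [d3 d30 h3] := is_derive_little_o (is_derive_sin (0 : R)) e10.
exists (Num.min (Num.min d1 d2) (Num.min d3 e1)) => [|k].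
  by rewrite !lt_min d10 d20 d30.
rewrite !lt_min => /andP[/andP[k1 k2] /andP[k3 k4]].
have [aR bI] := (le_Re_cabs k, le_Im_cabs k).
rewrite add0r cexp0 mul1r.
have := h1 (Re k) (le_lt_trans aR k1); have := h2 (Im k) (le_lt_trans bI k2).
have := h3 (Im k) (le_lt_trans bI k3).
rewrite !add0r expR0 cos0 sin0 oppr0 mul0r !subr0 !mul1r.
move: {k1 k2 k3 h1 h2 h3 d10 d20 d30 d1 d2 d3} (ltW k4) => {}k4.

move=> hs hc he; apply: le_trans (cabs_le_ReIm _) _.
rewrite /cexp !Re_sub !Im_sub Re_mul Im_mul /= !mul0r subr0 addr0 subr0.
have cb : `|cos (Im k)| <= 1 by rewrite ler_norml cos_geN1 cos_le1.
have sb : `|sin (Im k)| <= 1 by rewrite ler_norml sin_geN1 sin_le1.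
move: (Re k) (Im k) (cabs k) aR bI hs hc he k4 cb sb => a b r.
set E := expR a; set S := sin b; set C := cos b => aR bI hs hc he re cb sb.
have r0 : 0 <= r := le_trans (normr_ge0 _) aR.
have hs' : `|S - b| <= e1 * r by
  rewrite addr0 in hs; apply: le_trans hs _; rewrite ler_wpM2l// ltW.
have hc' : `|C - 1| <= e1 * r by apply: le_trans hc _; rewrite ler_wpM2l// ltW.
have he' : `|E - 1 - a| <= e1 * r by apply: le_trans he _; rewrite ler_wpM2l// ltW.
have a1 : `|1 + a| <= 2.
  by apply: le_trans (ler_normD _ _) _; rewrite normr1; lra.
have -> : E * C - 1 - a = (E - 1 - a) * C + (1 + a) * (C - 1) by ring.
have -> : E * S - b = (E - 1 - a) * S + (1 + a) * (S - b) + a * b by ring.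
have b1 : `|(E - 1 - a) * C| <= e1 * r.
  by rewrite normrM -[leRHS]mulr1 ler_pM.
have b2 : `|(1 + a) * (C - 1)| <= 2 * (e1 * r) by rewrite normrM ler_pM.
have b3 : `|(E - 1 - a) * S| <= e1 * r.
  by rewrite normrM -[leRHS]mulr1 ler_pM.
have b4 : `|(1 + a) * (S - b)| <= 2 * (e1 * r) by rewrite normrM ler_pM.
have b5 : `|a * b| <= e1 * r.
  by rewrite normrM ler_pM// (le_trans aR).
have c1 := ler_normD ((E - 1 - a) * C) ((1 + a) * (C - 1)).
have c2 := ler_normD ((E - 1 - a) * S) ((1 + a) * (S - b)).
have c3 := ler_normD ((E - 1 - a) * S + (1 + a) * (S - b)) (a * b).
have c4 : e1 * r <= e / 10 * r by rewrite ler_wpM2r.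
have c5 : 0 <= e * r by rewrite mulr_ge0// ltW.
lra.
Qed.

Lemma cdiff_cexp z : cdiff cexp z (cexp z).
Proof.
have := @cdiffM _ _ _ z _ _ (cdiff_cst (cexp z) z)
  (@cdiff_comp _ cexp (fun w => w - z) z 1 1 _ _).
rewrite mul0r add0r !mulr1.
have -> : (fun w => cexp z * cexp (w - z)) = cexp.
  by apply/funext => w; rewrite -cexpD addrC subrK.
apply; last by rewrite subrr; exact: cdiff_cexp0.
by rewrite -[X in cdiff _ _ X]addr0; apply: cdiffD (cdiff_id _) (cdiff_cst _ _).
Qed.

End complex_exponential.

(** * Continuity of complex-valued maps *)

Section complex_valued_maps.
Variable R : realType.

(** The target carries no topology here: only its real-valued modulus is used,
    so that continuity of real and imaginary parts and of moduli follows at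
    once. *)
Definition pcont (T : topologicalType) (u : T -> R[i]) :=
  forall (x : T) (e : R), 0 < e -> \forall y \near x, cabs (u y - u x) <= e.

Variable T : topologicalType.
Implicit Types (u v : T -> R[i]).

Lemma pcont_cst (z : R[i]) : pcont (fun _ : T => z).
Proof. by move=> x e e0; near=> y; rewrite subrr cabs0 ltW. Unshelve. all: end_near. Qed.

Lemma pcont_comp g u : (forall z, ccont g z) -> pcont u -> pcont (g \o u).
Proof.
move=> cg cu x e e0; have [d d0 hd] := cg (u x) e e0.
have d2 : 0 < d / 2 by rewrite divr_gt0.
near=> y; rewrite /= -[u y](subrK (u x)) [_ + u x]addrC; apply: hd.
have : cabs (u y - u x) <= d / 2 by near: y; exact: cu.
by move/le_lt_trans; apply; rewrite ltr_pdivrMr// ltr_pMr// ltr1n.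
Unshelve. all: end_near. Qed.

Lemma pcont_complex (a b : T -> R) : continuous a -> continuous b ->
  pcont (fun x => a x +i* b x).
Proof.
move=> ca cb x e e0; have e2 : 0 < e / 2 by rewrite divr_gt0.
near=> y; apply: le_trans (cabs_le_ReIm _) _ => /=.
have ha : `|a x - a y| <= e / 2 by near: y; have /cvgrPdist_le := ca x; apply.
have hb : `|b x - b y| <= e / 2 by near: y; have /cvgrPdist_le := cb x; apply.
by rewrite [e]splitr lerD// distrC.
Unshelve. all: end_near. Qed.

Lemma continuous_Re u : pcont u -> continuous (fun x => Re (u x)).
Proof.
move=> cu x; apply/cvgrPdist_le => e e0; near=> y.
rewrite distrC -Re_sub; apply: le_trans (le_Re_cabs _) _.
by near: y; exact: cu.
Unshelve. all: end_near. Qed.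

Lemma continuous_Im u : pcont u -> continuous (fun x => Im (u x)).
Proof.
move=> cu x; apply/cvgrPdist_le => e e0; near=> y.
rewrite distrC -Im_sub; apply: le_trans (le_Im_cabs _) _.
by near: y; exact: cu.
Unshelve. all: end_near. Qed.

Lemma continuous_cabs u : pcont u -> continuous (fun x => cabs (u x)).
Proof.
move=> cu x; apply/cvgrPdist_le => e e0; near=> y.
have : cabs (u y - u x) <= e by near: y; exact: cu.
have := cabsD (u y - u x) (u x); have := cabsD (u x - u y) (u y).
rewrite !subrK [cabs (u x - _)]cabsC => h1 h2 h3.
by rewrite ler_norml; apply/andP; split; lra.
Unshelve. all: end_near. Qed.

Lemma pcontM u v : pcont u -> pcont v -> pcont (fun x => u x * v x).
Proof.
move=> cu cv.
have -> : (fun x => u x * v x) = fun x =>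
   (Re (u x) * Re (v x) - Im (u x) * Im (v x)) +i*
   (Re (u x) * Im (v x) + Im (u x) * Re (v x)).
  by apply/funext => x; case: (u x) (v x) => [a b] [c d].
have [a1 a2 b1 b2] := And4 (continuous_Re cu) (continuous_Im cu)
  (continuous_Re cv) (continuous_Im cv).
by apply: pcont_complex => x; [apply: cvgB|apply: cvgD]; apply: cvgM;
  first [exact: a1|exact: a2|exact: b1|exact: b2].
Qed.

Lemma pcontD u v : pcont u -> pcont v -> pcont (fun x => u x + v x).
Proof.
move=> cu cv.
have -> : (fun x => u x + v x) = fun x =>
   (Re (u x) + Re (v x)) +i* (Im (u x) + Im (v x)).
  by apply/funext => x; case: (u x) (v x) => [a b] [c d].
have [a1 a2 b1 b2] := And4 (continuous_Re cu) (continuous_Im cu)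
  (continuous_Re cv) (continuous_Im cv).
by apply: pcont_complex => x; apply: cvgD;
  first [exact: a1|exact: a2|exact: b1|exact: b2].
Qed.

Lemma pcont_conj u : pcont u -> pcont (fun x => conjc (u x)).
Proof. by move=> cu x e /(cu x); apply: filterS => y; rewrite -rmorphB cabs_conj. Qed.

End complex_valued_maps.

Section lines.
Variable R : realType.
Implicit Types (f : R[i] -> R[i]) (z w l c : R[i]).

Lemma pcont_cis : pcont (@cis R).
Proof. by apply: pcont_complex; [exact: continuous_cos|exact: continuous_sin]. Qed.

(** Every real-variable argument (fundamental theorem of calculus, mean value
    theorem) is applied to a holomorphic function along a line, after taking
    the real part of a multiple. *)
Lemma is_derive_line f z w l c (t : R) : cdiff f (z + t%:C * w) l ->
  is_derive t 1 (fun s : R => Re (c * f (z + s%:C * w))) (Re (c * (l * w))).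
Proof.
move=> df; apply: little_o_is_derive => e e0.
have [c0 w0] := (cabs_ge0 c, cabs_ge0 w).
have M0 : 0 < 1 + cabs c * cabs w by rewrite ltr_wpDr ?mulr_ge0.
have W0 : 0 < 1 + cabs w by rewrite ltr_wpDr.
have [|d d0 hd] := df (e / (1 + cabs c * cabs w)); first by rewrite divr_gt0.
exists (d / (1 + cabs w)) => [|h]; first by rewrite divr_gt0.
rewrite ltr_pdivlMr// => hh.
have hw : cabs (h%:C * w) = `|h| * cabs w by rewrite cabsM cabs_real.
have H : cabs (f (z + t%:C * w + h%:C * w) - f (z + t%:C * w) - l * (h%:C * w))
    <= e / (1 + cabs c * cabs w) * (`|h| * cabs w).
  rewrite -hw; apply: hd; rewrite hw.
  by apply: le_lt_trans hh; rewrite ler_wpM2l// lerDr.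
have -> : Re (c * f (z + (t + h)%:C * w)) - Re (c * f (z + t%:C * w)) -
     Re (c * (l * w)) * h =
   Re (c * (f (z + t%:C * w + h%:C * w) - f (z + t%:C * w) - l * (h%:C * w))).
  have -> : Re (c * (l * w)) * h = Re (c * (l * w) * h%:C).
    by rewrite [RHS]Re_mul /= mulr0 subr0.
  by rewrite -!Re_sub rmorphD; congr (Re _); rewrite mulrDl addrA; ring.
apply: le_trans (le_Re_cabs _) _; rewrite cabsM.
apply: le_trans (ler_wpM2l c0 H) _.
rewrite [leLHS](_ : _ = e * `|h| * ((cabs c * cabs w) / (1 + cabs c * cabs w))).
  apply: ler_piMr; first by rewrite mulr_ge0// ltW.
  by rewrite ler_pdivrMr// mul1r; lra.
by field; rewrite lt0r_neq0.
Qed.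

End lines.

(** * Integrals over segments and Goursat's theorem *)

Section segment_integral.
Variable R : realType.
Implicit Types (a b c k : R) (g : R -> R).

Definition sint a b g : R := \int[lebesgue_measure]_(x in `[a, b]) g x.

Lemma continuous_cst k : continuous (fun _ : R => k).
Proof. by apply: cst_continuous. Qed.

Lemma continuous_idR : continuous (fun x : R => x).
Proof. by move=> x; apply: cvg_id. Qed.

Lemma sint_integrable a b g : continuous g ->
  (@lebesgue_measure R).-integrable `[a, b] (EFin \o g).
Proof.
move=> cg; apply: continuous_compact_integrable; first exact: segment_compact.
exact: continuous_subspaceT.
Qed.

Lemma sint_fin a b g : continuous g ->
  (\int[lebesgue_measure]_(x in `[a, b]) (g x)%:E = (sint a b g)%:E)%E.
Proof.
by move=> cg; rewrite fineK//; apply: integrable_fin_num => //; exact: sint_integrable.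
Qed.

Lemma sintD a b g1 g2 : continuous g1 -> continuous g2 ->
  sint a b (fun x => g1 x + g2 x) = sint a b g1 + sint a b g2.
Proof. by move=> c1 c2; apply: RintegralD => //; exact: sint_integrable. Qed.

Lemma sintB a b g1 g2 : continuous g1 -> continuous g2 ->
  sint a b (fun x => g1 x - g2 x) = sint a b g1 - sint a b g2.
Proof. by move=> c1 c2; apply: RintegralB => //; exact: sint_integrable. Qed.

Lemma sintZ a b k g : continuous g ->
  sint a b (fun x => k * g x) = k * sint a b g.
Proof. by move=> cg; apply: RintegralZl => //; exact: sint_integrable. Qed.

Lemma sint_cst a b k : a <= b -> sint a b (fun=> k) = k * (b - a).
Proof.
move=> ab; rewrite /sint Rintegral_cst//= lebesgue_measure_itv /= lte_fin.
by case: ltP => // ba; have -> : a = b by [apply/le_anti; rewrite ab ba]; rewrite subrr.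
Qed.

Lemma le_sint a b g1 g2 : continuous g1 -> continuous g2 ->
  (forall x, a <= x <= b -> g1 x <= g2 x) -> sint a b g1 <= sint a b g2.
Proof.
by move=> c1 c2 h; apply: le_Rintegral => //; exact: sint_integrable.
Qed.

Lemma eq_sint a b g1 g2 : (forall x, g1 x = g2 x) -> sint a b g1 = sint a b g2.
Proof. by move=> h; congr sint; apply/funext. Qed.

Lemma sint_cat a c b g : continuous g -> a <= c -> c <= b ->
  sint a b g = sint a c g + sint c b g.
Proof.
move=> cg ac cb; apply/eqP; rewrite addrC -subr_eq; apply/eqP.
rewrite /sint (@Rintegral_itvB _ g (BLeft a) (BRight b) c) ?bnd_simp//.
  apply: Rintegral_itv_obnd_cbnd; have := sint_integrable c b cg.
  by apply: integrableS => //; exact: subset_itv_oc_cc.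
exact: sint_integrable.
Qed.

Lemma sint_approx a b k e g : continuous g -> a <= b ->
  (forall x, a <= x <= b -> `|g x - k| <= e) ->
  `|sint a b g - k * (b - a)| <= e * (b - a).
Proof.
move=> cg ab h.
have ck := continuous_cst.
have lo : (k - e) * (b - a) <= sint a b g.
  rewrite -sint_cst//; apply: le_sint => // x /h.
  by rewrite ler_norml => /andP[]; lra.
have hi : sint a b g <= (k + e) * (b - a).
  rewrite -sint_cst//; apply: le_sint => // x /h.
  by rewrite ler_norml => /andP[]; lra.
by rewrite ler_norml; apply/andP; split; lra.
Qed.

Lemma sint_FTC a b g (G : R -> R) : continuous g -> a <= b ->
  (forall x : R, is_derive x 1 G (g x)) -> sint a b g = G b - G a.
Proof.
move=> cg; rewrite le_eqVlt => /predU1P[->|ab] dG.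
  by rewrite /sint set_itv1 Rintegral_set1 subrr.
have cG : continuous G.
  by move=> x; apply/differentiable_continuous/derivable1_diffP; have [] := dG x.
apply: EFin_inj; rewrite -sint_fin// (@continuous_FTC2 _ g G)//.
- exact: continuous_subspaceT.
- split=> [x _||]; first by have [] := dG x.
  + exact/cvg_at_right_filter/cG.
  + exact/cvg_at_left_filter/cG.
- by move=> x _; rewrite derive1E; have [] := dG x.
Qed.

End segment_integral.

Section goursat.
Variable R : realType.
Variables (h : R[i] -> R[i]).
Hypothesis holo : forall z, exists l, cdiff h z l.
Implicit Types a b c d x y : R.

Let ccont_h z : ccont h z. Proof. by have [l /cdiff_ccont] := holo z. Qed.

Let continuous_vert a : continuous (fun y => Re (h (a +i* y))).
Proof.
by apply: continuous_Re; apply: pcont_comp => //; apply: pcont_complex;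
  [exact: continuous_cst|exact: continuous_idR].
Qed.

Let continuous_horiz c : continuous (fun x => Im (h (x +i* c))).
Proof.
by apply: continuous_Im; apply: pcont_comp => //; apply: pcont_complex;
  [exact: continuous_idR|exact: continuous_cst].
Qed.

(** Real part of the integral of h dz / i along the boundary of a rectangle. *)
Let flux a b c d : R :=
  sint c d (fun y => Re (h (b +i* y)) - Re (h (a +i* y)))
  - sint a b (fun x => Im (h (x +i* d)) - Im (h (x +i* c))).

Let fluxE a b c d : flux a b c d =
  sint c d (fun y => Re (h (b +i* y))) - sint c d (fun y => Re (h (a +i* y)))
  - (sint a b (fun x => Im (h (x +i* d))) - sint a b (fun x => Im (h (x +i* c)))).
Proof. by rewrite /flux !sintB. Qed.

Let flux_quarters a m b c n d : a <= m -> m <= b -> c <= n -> n <= d ->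
  flux a b c d = flux a m c n + flux m b c n + flux a m n d + flux m b n d.
Proof.
move=> am mb cn nd; rewrite !fluxE.
rewrite !(@sint_cat R c n d)// !(@sint_cat R a m b)//; ring.
Qed.

(** The differential of h contributes nothing to the flux, its variations
    across opposite sides being constant and equal; only the error remains. *)
Let flux_small z l e a b c d : a <= Re z <= b -> c <= Im z <= d -> 0 < e ->
  (forall w, cabs (w - z) <= (b - a) + (d - c) ->
     cabs (h w - h z - l * (w - z)) <= e * cabs (w - z)) ->
  `|flux a b c d| <= 2 * e * ((b - a) + (d - c)) ^+ 2.
Proof.
move=> /andP[az zb] /andP[cz zd] e0 hz.
have ab := le_trans az zb; have cd := le_trans cz zd.
set r := (b - a) + (d - c).
have r0 : 0 <= r by rewrite /r; lra.
have near_z x y : a <= x <= b -> c <= y <= d -> cabs ((x +i* y) - z) <= r.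
  move=> /andP[ax xb] /andP[cy yd]; apply: le_trans (cabs_le_ReIm _) _.
  by rewrite Re_sub Im_sub /= lerD// ler_norml; apply/andP; split; lra.
have err x y : a <= x <= b -> c <= y <= d ->
    cabs (h (x +i* y) - h z - l * ((x +i* y) - z)) <= e * r.
  move=> hx hy; apply: le_trans (hz _ (near_z _ _ hx hy)) _.
  by rewrite ler_wpM2l ?near_z// ltW.
have [a1 b1] : a <= a <= b /\ a <= b <= b by rewrite !lexx ab.
have [c1 d1] : c <= c <= d /\ c <= d <= d by rewrite !lexx cd.
have V y : c <= y <= d ->
    `|(Re (h (b +i* y)) - Re (h (a +i* y))) - Re l * (b - a)| <= 2 * e * r.
  move=> hy.
  have -> : Re (h (b +i* y)) - Re (h (a +i* y)) - Re l * (b - a) =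
    Re (h (b +i* y) - h z - l * ((b +i* y) - z)) -
    Re (h (a +i* y) - h z - l * ((a +i* y) - z)).
    by rewrite !Re_sub !Re_mul !Re_sub !Im_sub /=; ring.
  apply: le_trans (ler_normB _ _) _.
  apply: le_trans (lerD (le_Re_cabs _) (le_Re_cabs _)) _.
  by have := err _ _ a1 hy; have := err _ _ b1 hy; lra.
have H x : a <= x <= b ->
    `|(Im (h (x +i* d)) - Im (h (x +i* c))) - Re l * (d - c)| <= 2 * e * r.
  move=> hx.
  have -> : Im (h (x +i* d)) - Im (h (x +i* c)) - Re l * (d - c) =
    Im (h (x +i* d) - h z - l * ((x +i* d) - z)) -
    Im (h (x +i* c) - h z - l * ((x +i* c) - z)).
    by rewrite !Im_sub !Im_mul !Re_sub !Im_sub /=; ring.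
  apply: le_trans (ler_normB _ _) _.
  apply: le_trans (lerD (le_Im_cabs _) (le_Im_cabs _)) _.
  by have := err _ _ hx c1; have := err _ _ hx d1; lra.
have cV : continuous (fun y => Re (h (b +i* y)) - Re (h (a +i* y))).
  by move=> y; apply: cvgB; exact: continuous_vert.
have cH : continuous (fun x => Im (h (x +i* d)) - Im (h (x +i* c))).
  by move=> y; apply: cvgB; exact: continuous_horiz.
have := sint_approx cV cd V; have := sint_approx cH ab H; rewrite /flux.
set p := sint c d _; set q := sint a b _; rewrite !ler_norml.
move=> /andP[q1 q2] /andP[p1 p2]; have rr : r = (b - a) + (d - c) by [].
have -> : 2 * e * r ^+ 2 = 2 * e * r * (b - a) + 2 * e * r * (d - c).
  by rewrite expr2 mulrA -mulrDr.
by apply/andP; split; nra.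
Qed.

(** Goursat's theorem for rectangles: the flux is additive under quartering and,
    by differentiability at z, is o(diameter^2) on small rectangles around z.
    If it did not vanish on the given rectangle, repeated quartering would
    produce nested rectangles carrying at least 4^(-k) of it, shrinking to a
    point where this is contradicted. *)
Lemma goursat a b c d : a <= b -> c <= d ->
  sint c d (fun y => Re (h (b +i* y))) - sint c d (fun y => Re (h (a +i* y)))
  = sint a b (fun x => Im (h (x +i* d))) - sint a b (fun x => Im (h (x +i* c))).
Proof.
move=> ab cd; apply/eqP; rewrite -subr_eq0 -fluxE; apply/negP => /negP E0.
pose W k : R := (b - a) / 2 ^+ k; pose H k : R := (d - c) / 2 ^+ k.
pose F (p : R * R) k := flux p.1 (p.1 + W k) p.2 (p.2 + H k).
have W0 k : 0 <= W k by rewrite divr_ge0 ?subr_ge0// exprn_ge0.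
have H0 k : 0 <= H k by rewrite divr_ge0 ?subr_ge0// exprn_ge0.
have WS k : W k = W k.+1 + W k.+1.
  by rewrite /W exprS invfM; field; rewrite expf_neq0.
have HS k : H k = H k.+1 + H k.+1.
  by rewrite /H exprS invfM; field; rewrite expf_neq0.
(* p is the lower left corner of a rectangle of the k-th generation *)
have step k (p : R * R) : exists q : R * R,
  [/\ p.1 <= q.1, q.1 + W k.+1 <= p.1 + W k, p.2 <= q.2,
      q.2 + H k.+1 <= p.2 + H k & `|F p k| <= 4 * `|F q k.+1|].
  have [W1 H1] := (W0 k.+1, H0 k.+1).
  have := @flux_quarters p.1 (p.1 + W k.+1) (p.1 + W k) p.2 (p.2 + H k.+1) (p.2 + H k).
  rewrite (WS k) (HS k) !addrA !lerDl W1 H1 => /(_ isT isT isT isT).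
  pose q1 := p; pose q2 := (p.1 + W k.+1, p.2); pose q3 := (p.1, p.2 + H k.+1).
  pose q4 := (p.1 + W k.+1, p.2 + H k.+1).
  move=> E.
  have {}E : F p k = F q1 k.+1 + F q2 k.+1 + F q3 k.+1 + F q4 k.+1.
    by rewrite /F /= (WS k) (HS k) !addrA E.
  have N := ler_normD (F q1 k.+1 + F q2 k.+1 + F q3 k.+1) (F q4 k.+1).
  have N2 := ler_normD (F q1 k.+1 + F q2 k.+1) (F q3 k.+1).
  have N3 := ler_normD (F q1 k.+1) (F q2 k.+1).
  rewrite -E in N.
  have [h1|h1] := leP `|F p k| (4 * `|F q1 k.+1|).
    by exists q1; split=> //=; lra.
  have [h2|h2] := leP `|F p k| (4 * `|F q2 k.+1|).
    by exists q2; split=> //=; lra.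
  have [h3|h3] := leP `|F p k| (4 * `|F q3 k.+1|).
    by exists q3; split=> //=; lra.
  by exists q4; split=> //=; lra.
have /choice[next nextP] : forall kp : nat * (R * R), exists q : R * R,
  [/\ kp.2.1 <= q.1, q.1 + W kp.1.+1 <= kp.2.1 + W kp.1, kp.2.2 <= q.2,
      q.2 + H kp.1.+1 <= kp.2.2 + H kp.1 & `|F kp.2 kp.1| <= 4 * `|F q kp.1.+1|].
  by move=> [k p]; exact: step.
pose P := fix P k := if k is j.+1 then next (j, P j) else (a, c).
have PS k := nextP (k, P k).
have big k : `|flux a b c d| <= 4 ^+ k * `|F (P k) k|.
  elim: k => [|k IH].
    by rewrite expr0 mul1r /F /= /W /H expr0 !divr1 !subrKC.
  apply: le_trans IH _; rewrite exprSr -mulrA ler_wpM2l ?exprn_ge0//.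
  by have [] := PS k.
have nest k j : [/\ (P k).1 <= (P (k + j)%N).1,
    (P (k + j)%N).1 + W (k + j)%N <= (P k).1 + W k, (P k).2 <= (P (k + j)%N).2 &
    (P (k + j)%N).2 + H (k + j)%N <= (P k).2 + H k].
  elim: j => [|j [i1 i2 i3 i4]]; first by rewrite addn0.
  by have [/= j1 j2 j3 j4 _] := PS (k + j)%N; rewrite addnS; split; lra.
have nest1 k j : (P j).1 <= (P k).1 + W k /\ (P j).2 <= (P k).2 + H k.
  have [i1 i2 i3 i4] := nest k j; have [j1 j2 j3 j4] := nest j k.
  have := W0 (k + j)%N; have := H0 (k + j)%N; rewrite addnC in j1 j3 *.
  by move=> w1 w2; split; lra.
pose X := range (fun k => (P k).1); pose Y := range (fun k => (P k).2).
have hX : has_sup X.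
  split; first by exists (P 0%N).1, 0%N.
  by exists ((P 0%N).1 + W 0%N) => _ [j _ <-]; have [] := nest1 0%N j.
have hY : has_sup Y.
  split; first by exists (P 0%N).2, 0%N.
  by exists ((P 0%N).2 + H 0%N) => _ [j _ <-]; have [] := nest1 0%N j.
pose z := sup X +i* sup Y.
have zX k : (P k).1 <= Re z <= (P k).1 + W k.
  apply/andP; split; first by apply: ub_le_sup; [case: hX|exists k].
  by apply: ge_sup; [case: hX|move=> _ [j _ <-]; have [] := nest1 k j].
have zY k : (P k).2 <= Im z <= (P k).2 + H k.
  apply/andP; split; first by apply: ub_le_sup; [case: hY|exists k].
  by apply: ge_sup; [case: hY|move=> _ [j _ <-]; have [] := nest1 k j].
have [l dz] := holo z.
pose D := (b - a) + (d - c).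
have D0 : 0 <= D by rewrite /D; lra.
have N0 : 0 < `|flux a b c d| by rewrite normr_gt0.
(* this e makes 2 e D^2 smaller than half the flux; the summand 1 covers D = 0 *)
pose e := `|flux a b c d| / (4 * (D ^+ 2 + 1)).
have D1 : 0 < D ^+ 2 + 1 by rewrite ltr_wpDl ?sqr_ge0.
have e0 : 0 < e by rewrite divr_gt0// mulr_gt0.
have [dd d0 hd] := dz e e0.
have [k kD] : exists k, W k + H k < dd.
  have [n Dn] : exists n : nat, D / dd < n%:R.
    by exists (Num.truncn (D / dd)).+1; exact: truncnS_gt.
  exists n; rewrite -mulrDl ltr_pdivrMr ?exprn_gt0//.
  move: Dn; rewrite ltr_pdivrMr// => /lt_le_trans; apply.
  by rewrite mulrC (ler_wpM2l (ltW d0))// -natrX ler_nat ltnW// ltn_expl.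
have := big k.
have hsm w : cabs (w - z) <= W k + H k ->
    cabs (h w - h z - l * (w - z)) <= e * cabs (w - z).
  by move=> wD; have := hd (w - z) (le_lt_trans wD kD); rewrite subrKC.
have S : `|F (P k) k| <= 2 * e * (W k + H k) ^+ 2.
  have := @flux_small z l e (P k).1 ((P k).1 + W k) (P k).2 ((P k).2 + H k)
    (zX k) (zY k) e0.
  by rewrite ![_ + _ - (P k).1]addrAC ![_ + _ - (P k).2]addrAC !subrr !add0r; apply.
move=> B.
have WH : W k + H k = D / 2 ^+ k by rewrite /W /H -mulrDl.
have : `|flux a b c d| <= 2 * e * D ^+ 2.
  apply: le_trans B _.
  apply: le_trans (ler_wpM2l _ S) _; first by rewrite exprn_ge0.
  rewrite WH expr_div_n -exprM mulnC exprM.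
  have -> : 2 ^+ 2 = 4 :> R by ring.
  by rewrite le_eqVlt; apply/orP; left; apply/eqP; field; rewrite expf_neq0.
have -> : 2 * e * D ^+ 2 = `|flux a b c d| * (D ^+ 2 / (D ^+ 2 + 1) / 2).
  by rewrite /e; field; rewrite lt0r_neq0.
rewrite leNgt gtr_pMr// => /negP; apply.
rewrite ltr_pdivrMr// ltr_pdivrMr// mul1r; have := sqr_ge0 D; lra.
Qed.

End goursat.

(** * Cauchy's formulas on circles *)

Section holomorphic.
Variable R : realType.
Implicit Types (f g h : R[i] -> R[i]) (z w c : R[i]).

Definition holo f := forall z, exists l, cdiff f z l.

Lemma holo_ccont f : holo f -> forall z, ccont f z.
Proof. by move=> hf z; have [l /cdiff_ccont] := hf z. Qed.

Lemma holo_cst c : holo (fun=> c).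
Proof. by move=> z; exists 0; exact: cdiff_cst. Qed.

Lemma holo_id : holo id.
Proof. by move=> z; exists 1; exact: cdiff_id. Qed.

Lemma holo_cexp : holo (@cexp R).
Proof. by move=> z; exists (cexp z); exact: cdiff_cexp. Qed.

Lemma holoD f g : holo f -> holo g -> holo (fun z => f z + g z).
Proof.
move=> hf hg z; have [l lf] := hf z; have [m mg] := hg z.
by exists (l + m); exact: cdiffD.
Qed.

Lemma holoM f g : holo f -> holo g -> holo (fun z => f z * g z).
Proof.
move=> hf hg z; have [l lf] := hf z; have [m mg] := hg z.
by exists (l * g z + f z * m); exact: cdiffM.
Qed.

Lemma holo_comp f g : holo f -> holo g -> holo (fun z => f (g z)).
Proof.
move=> hf hg z; have [m mg] := hg z; have [l lf] := hf (g z).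
by exists (l * m); exact: cdiff_comp.
Qed.

Lemma holo_reflect f : holo f -> holo (fun z => conjc (f (conjc z))).
Proof.
by move=> hf z; have [l lf] := hf (conjc z); exists (conjc l); exact: cdiff_conj.
Qed.

Lemma holoB_cst f c : holo f -> holo (fun z => f z - c).
Proof. by move=> hf; apply: holoD hf (holo_cst _). Qed.

Lemma holo_affine c w : holo (fun z => c * z + w).
Proof. by apply: holoD (holo_cst _); apply: holoM (holo_cst _) holo_id. Qed.

Lemma holo_opp : holo (@GRing.opp R[i]).
Proof.
have -> : @GRing.opp R[i] = fun z => -1 * z + 0.
  by apply/funext => z; rewrite mulN1r addr0.
exact: holo_affine.
Qed.

Lemma pcont_holo (T : topologicalType) f (u : T -> R[i]) :
  holo f -> pcont u -> pcont (fun x => f (u x)).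
Proof. by move=> hf; apply: pcont_comp => z; exact: holo_ccont. Qed.

End holomorphic.

Section circle_means.
Variable R : realType.
Implicit Types (f g h : R[i] -> R[i]) (z w c : R[i]) (u : R -> R).

Definition circ u : R := sint 0 (pi *+ 2) u.

Lemma tau_ge0 : 0 <= pi *+ 2 :> R. Proof. by rewrite mulrn_wge0 ?pi_ge0. Qed.
Lemma tau_gt0 : 0 < pi *+ 2 :> R. Proof. by rewrite pmulrn_lgt0 ?pi_gt0. Qed.

Lemma circ_cst (k : R) : circ (fun=> k) = (pi *+ 2) * k.
Proof. by rewrite /circ sint_cst ?tau_ge0// subr0 mulrC. Qed.

Lemma circ_approx u (k e : R) : continuous u ->
  (forall t, `|u t - k| <= e) -> `|circ u - (pi *+ 2) * k| <= (pi *+ 2) * e.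
Proof.
move=> cu h; have := @sint_approx _ 0 (pi *+ 2) k e u cu tau_ge0 (fun t _ => h t).
by rewrite subr0 ![_ * (pi *+ 2)]mulrC.
Qed.

Lemma circ_le u (e : R) : continuous u ->
  (forall t, 0 <= t <= pi *+ 2 -> u t <= e) -> circ u <= (pi *+ 2) * e.
Proof.
by move=> cu h; rewrite -circ_cst; apply: le_sint => //; apply: continuous_cst.
Qed.

(** Translating the circle in the logarithmic coordinate does not change the
    mean of a holomorphic function: the horizontal sides of the rectangle in
    Goursat's theorem cancel by periodicity. *)
Lemma periodic_mean_const h (a b : R) : holo h ->
  (forall w, h (w + 0 +i* (pi *+ 2)) = h w) -> a <= b ->
  circ (fun y => Re (h (b +i* y))) = circ (fun y => Re (h (a +i* y))).
Proof.
move=> hh hp ab; apply/eqP; rewrite -subr_eq0 /circ.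
rewrite (goursat hh ab tau_ge0) subr_eq0; apply/eqP/eq_sint => x.
rewrite -[in RHS]hp; congr (Im (h _)).
by apply/eqP; rewrite eq_complex /= addr0 add0r !eqxx.
Qed.

(** The constant mean is computed by letting the real part tend to minus
    infinity, where h approaches z. *)
Lemma periodic_mean_limit h z (s : R) : holo h ->
  (forall w, h (w + 0 +i* (pi *+ 2)) = h w) ->
  (forall e : R, 0 < e -> exists2 d : R, 0 < d &
     forall w, expR (Re w) < d -> cabs (h w - z) <= e) ->
  circ (fun y => Re (h (s +i* y))) = (pi *+ 2) * Re z.
Proof.
move=> hh hp hz; apply/eqP; rewrite -subr_eq0 -normr_le0.
apply/ler_addgt0Pr => e e0; rewrite add0r.
have [d d0 hd] := hz (e / (pi *+ 2)) (divr_gt0 e0 tau_gt0).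
pose a := Num.min s (ln d - 1).
rewrite (periodic_mean_const (a := a) hh hp) ?ge_min ?lexx//.
have -> : e = (pi *+ 2) * (e / (pi *+ 2)).
  by rewrite mulrC divfK ?lt0r_neq0 ?tau_gt0.
apply: circ_approx => [|t].
  apply: continuous_Re; apply: pcont_holo => //.
  by apply: pcont_complex; [exact: continuous_cst|exact: continuous_idR].
rewrite -Re_sub; apply: le_trans (le_Re_cabs _) _; apply: hd => /=.
rewrite -[d]lnK// ltr_expR; apply: (@le_lt_trans _ _ (ln d - 1)).
  by rewrite ge_min lexx orbT.
by rewrite gtrDl oppr_lt0.
Qed.

(** The function w |-> g (e^w) is 2 pi i - periodic and tends to g 0. *)
Lemma mean_value g : holo g ->
  circ (fun t => Re (g (cis t))) = (pi *+ 2) * Re (g 0).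
Proof.
move=> hg.
have := @periodic_mean_limit (fun w => g (cexp w)) (g 0) 0.
rewrite /cexp /= expR0 => <-.
- by apply: eq_sint => t; rewrite mul1r.
- exact: holo_comp hg (@holo_cexp R).
- by move=> w; rewrite -!/(cexp _) cexp_period.
- move=> e e0; have [d d0 hd] := holo_ccont hg 0 e0; exists d => // w wd.
  by rewrite -!/(cexp _) -[cexp w]add0r; apply: hd; rewrite cabs_cexp.
Qed.

Variables (f F : R[i] -> R[i]).
Hypothesis dF : forall z, cdiff f z (F z).

Let hf : holo f. Proof. by move=> z; exists (F z). Qed.

(** The difference quotient (f (z + e^w) - f z) / e^w, a 2 pi i - periodic
    function of w, tends to F z by the definition of the derivative. *)
Lemma cauchy_derivative z c :
  circ (fun t => Re (c * ((f (z + cis t) - f z) * cis (- t)))) =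
  (pi *+ 2) * Re (c * F z).
Proof.
rewrite -(@periodic_mean_limit
  (fun w => c * ((f (z + cexp w) - f z) * cexp (- w))) (c * F z) 0).
- apply: eq_sint => t.
  by rewrite /cexp /= oppr0 expR0 !mul1r.
- apply: holoM (holo_cst _) _; apply: holoM.
    apply: holoB_cst; apply: holo_comp hf _.
    by apply: holoD (holo_cst _) _; exact: holo_cexp.
  exact: holo_comp (@holo_cexp R) (@holo_opp R).
- move=> w; rewrite cexp_period; congr (c * (_ * _)).
  by rewrite !cexpN cexp_period.
- move=> e e0.
  have M0 : 0 < 1 + cabs c by rewrite ltr_wpDr ?cabs_ge0.
  have [d d0 hd] := dF z (divr_gt0 e0 M0); exists d => // w wd.
  have c0 : cexp w != 0 by rewrite -cabs_eq0 cabs_cexp lt0r_neq0 ?expR_gt0.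
  have := hd (cexp w); rewrite cabs_cexp => /(_ wd) H.
  rewrite -mulrBr cexpN.
  have -> : (f (z + cexp w) - f z) / cexp w - F z =
    (f (z + cexp w) - f z - F z * cexp w) / cexp w.
    by rewrite [RHS]mulrBl mulfK.
  rewrite !cabsM cabsV cabs_cexp; apply: (@le_trans _ _ (cabs c * (e / (1 + cabs c)))).
    by rewrite ler_wpM2l ?cabs_ge0// ler_pdivrMr ?expR_gt0.
  rewrite mulrCA ler_piMr ?ltW// ltr_pdivrMr// mul1r; lra.
Qed.

(** Compactness of the circle makes continuity uniform along it. *)
Lemma uniform_on_circle g z (e : R) : (forall z, ccont g z) -> 0 < e ->
  exists2 d, 0 < d & forall k, cabs k < d -> forall t, 0 <= t <= pi *+ 2 ->
    cabs (g (z + cis t + k) - g (z + cis t)) <= e.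
Proof.
move=> cg e0.
have /compact_near_coveringP K := @segment_compact R 0 (pi *+ 2).
pose P (d t : R) := forall k, cabs k < d ->
  cabs (g (z + cis t + k) - g (z + cis t)) <= e.
have K1 : forall x, `[0, pi *+ 2] x ->
    \forall x' \near x & i \near 0^'+, P i x'.
  move=> x _; have e2 : 0 < e / 2 by rewrite divr_gt0.
  have [r r0 hr] := cg (z + cis x) _ e2.
  have r2 : 0 < r / 2 by rewrite divr_gt0.
  near=> t d => k kd.
  have tx : cabs (cis t - cis x) <= r / 2.
    by near: t; exact: pcont_cis.
  have dr : d < r / 2 by near: d; exact: nbhs_right_lt.
  have h1 : cabs (g (z + cis t + k) - g (z + cis x)) <= e / 2.
    have -> : z + cis t + k = z + cis x + (cis t - cis x + k) by ring.
    apply: hr; apply: le_lt_trans (cabsD _ _) _.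
    by rewrite [r]splitr; apply: ler_ltD => //; exact: lt_trans kd dr.
  have h2 : cabs (g (z + cis t) - g (z + cis x)) <= e / 2.
    have -> : z + cis t = z + cis x + (cis t - cis x) by ring.
    apply: hr; apply: le_lt_trans tx _.
    by rewrite ltr_pdivrMr// ltr_pMr// ltr1n.
  by have := cabs_tri (g (z + cis t + k)) (g (z + cis x)) (g (z + cis t));
    rewrite [cabs (g (z + cis x) - _)]cabsC; lra.
have H := K R (0^'+) P _ K1.
have [d [d0 hd]] : exists d : R, 0 < d /\ (`[0, pi *+ 2] `<=` P d).
  near (0 : R)^'+ => d; exists d; split => //.
  by near: d; exact: H.
exists d => // k kd t t0; apply: hd => //=; by rewrite in_itv.
Unshelve. all: end_near. Qed.

(** Mean value inequality for w |-> f w - F z * w on the segment from z to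
    z + k. *)
Lemma taylor1 z k (e : R) :
  (forall t, 0 <= t <= 1 -> cabs (F (z + t%:C * k) - F z) <= e) ->
  cabs (f (z + k) - f z - F z * k) <= e * cabs k.
Proof.
move=> H; apply: cabs_le_Re => c c1.
have dg w : cdiff (fun w => f w - F z * w) w (F w - F z).
  have := cdiffD (dF w) (cdiffM (cdiff_cst (- F z) w) (cdiff_id w)).
  rewrite mul0r add0r mulr1; congr (cdiff _ _ _).
  by apply/funext => v; rewrite mulNr.
pose phi (t : R) := Re (c * (f (z + t%:C * k) - F z * (z + t%:C * k))).
have dphi (t : R) : is_derive t 1 phi (Re (c * ((F (z + t%:C * k) - F z) * k))).
  exact: is_derive_line (dg _).
have [|t t01 E] := @MVT_segment _ phi _ 0 1 ler01 (fun t _ => dphi t).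
  apply: continuous_subspaceT => t.
  by apply/differentiable_continuous/derivable1_diffP; have [] := dphi t.
have -> : c * (f (z + k) - f z - F z * k) =
  c * (f (z + 1%:C * k) - F z * (z + 1%:C * k)) -
  c * (f (z + 0%:C * k) - F z * (z + 0%:C * k)).
  by rewrite !(mul1r, mul0r, addr0); ring.
rewrite Re_sub -!/(phi _) E subr0 mulr1.
apply: le_trans (ler_norm _) (le_trans (le_Re_cabs _) _).
rewrite !cabsM c1 mul1r ler_wpM2r ?cabs_ge0// H//.
Qed.

Let pcont_quot g z : (forall z, ccont g z) ->
  pcont (fun t => (g (z + cis t) - g z) * cis (- t)).
Proof.
move=> cg; apply: pcontM.
  apply: pcontD; last exact: pcont_cst.
  apply: (@pcont_comp _ _ g) => //.
  by apply: pcontD; [exact: pcont_cst|exact: pcont_cis].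
apply: pcont_complex => t.
  by apply: continuous_comp; [exact: oppr_continuous|exact: continuous_cos].
by apply: continuous_comp; [exact: oppr_continuous|exact: continuous_sin].
Qed.

Let continuous_scale (k : R) (u : R -> R) :
  continuous u -> continuous (fun t => k * u t).
Proof. by move=> cu t; apply: cvgM; [apply: cvg_cst|exact: cu]. Qed.

Let continuous_ReM c (u : R -> R[i]) : pcont u -> continuous (fun t => Re (c * u t)).
Proof. by move=> cu; apply: continuous_Re; apply: pcontM => //; exact: pcont_cst. Qed.

(** Cauchy's formula expresses F through the values of f on unit circles, and f
    is uniformly continuous there. *)
Lemma derivative_ccont z : ccont F z.
Proof.
move=> e e0; have e2 : 0 < e / 2 by rewrite divr_gt0.
have [d1 d10 h1] := uniform_on_circle z (holo_ccont hf) e2.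
have [d2 d20 h2] := holo_ccont hf z e2.
exists (Num.min d1 d2) => [|k]; first by rewrite lt_min d10.
rewrite lt_min => /andP[k1 k2]; apply: cabs_le_Re => c c1.
rewrite -(ler_pM2l tau_gt0) mulrBr Re_sub mulrBr -!cauchy_derivative.
rewrite -sintB; [|exact: continuous_ReM (pcont_quot _ (holo_ccont hf))..].
apply: circ_le => [t|t t0].
  by apply: cvgB; exact: continuous_ReM (pcont_quot _ (holo_ccont hf)) _.
rewrite -Re_sub -mulrBr -mulrBl.
apply: le_trans (ler_norm _) (le_trans (le_Re_cabs _) _).
rewrite !cabsM c1 cabs_cis mul1r mulr1.
have -> : f (z + k + cis t) - f (z + k) - (f (z + cis t) - f z) =
  (f (z + cis t + k) - f (z + cis t)) - (f (z + k) - f z).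
  by rewrite [z + k + _]addrAC; ring.
by have := cabsB (f (z + cis t + k) - f (z + cis t)) (f (z + k) - f z);
  have := h1 _ k1 _ t0; have := h2 _ k2; lra.
Qed.

(** Goursat: a derivative is holomorphic. The same formula with F in place of f
    provides a candidate l for the derivative of F at z; since F is continuous,
    the difference quotients of f converge to F uniformly on the circle, and so
    do their means. *)
Lemma derivative_holo : holo F.
Proof.
move=> z.
pose u t := (F (z + cis t) - F z) * cis (- t).
have cu : pcont u by exact: pcont_quot derivative_ccont.
pose l := (circ (fun t => Re (u t)) / (pi *+ 2)) +i*
  (circ (fun t => Im (u t)) / (pi *+ 2)).
have cRe := continuous_Re cu; have cIm := continuous_Im cu.
have lE c : (pi *+ 2) * Re (c * l) = circ (fun t => Re (c * u t)).
  have -> : (fun t => Re (c * u t)) = (fun t => Re c * Re (u t) - Im c * Im (u t)).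
    by apply/funext => t; rewrite Re_mul.
  rewrite /circ sintB; [|exact: continuous_scale..].
  rewrite !sintZ// Re_mul /= /circ.
  by move: (pi *+ 2) (lt0r_neq0 tau_gt0) => p p0; field.
exists l => e e0; have e2 : 0 < e / 2 by rewrite divr_gt0.
have [d1 d10 h1] := uniform_on_circle z derivative_ccont e2.
have [d2 d20 h2] := derivative_ccont z e2.
exists (Num.min d1 d2) => [|k]; first by rewrite lt_min d10.
rewrite lt_min => /andP[k1 k2]; apply: cabs_le_Re => c c1.
have small (d t : R) : 0 <= t <= 1 -> cabs k < d -> cabs (t%:C * k) < d.
  move=> /andP[t0 t1]; apply: le_lt_trans; rewrite cabsM cabs_real ger0_norm//.
  by rewrite ler_piMl ?cabs_ge0.
rewrite -(ler_pM2l tau_gt0) !mulrBr !Re_sub !mulrBr -!cauchy_derivative.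
have -> : c * (l * k) = (c * k) * l by ring.
rewrite lE.
have cq c' z' : continuous (fun t => Re (c' * ((f (z' + cis t) - f z') * cis (- t)))).
  by exact: continuous_ReM (pcont_quot _ (holo_ccont hf)).
rewrite -sintB// -sintB//; [|by move=> t; apply: cvgB; exact: cq|exact: continuous_ReM].
apply: circ_le => [t|t t0].
  by apply: cvgB; [apply: cvgB; exact: cq|exact: continuous_ReM].
rewrite -!Re_sub.
have -> : c * ((f (z + k + cis t) - f (z + k)) * cis (- t)) -
  c * ((f (z + cis t) - f z) * cis (- t)) - c * k * u t =
  c * (((f (z + cis t + k) - f (z + cis t) - F (z + cis t) * k) -
        (f (z + k) - f z - F z * k)) * cis (- t)).
  by rewrite /u [z + k + _]addrAC; ring.
apply: le_trans (ler_norm _) (le_trans (le_Re_cabs _) _).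
rewrite !cabsM c1 cabs_cis mul1r mulr1.
have := @taylor1 (z + cis t) k (e / 2) (fun s s01 => h1 _ (small _ _ s01 k1) _ t0).
have := @taylor1 z k (e / 2) (fun s s01 => h2 _ (small _ _ s01 k2)).
by have := cabsB (f (z + cis t + k) - f (z + cis t) - F (z + cis t) * k)
  (f (z + k) - f z - F z * k); lra.
Qed.

End circle_means.

(** * Square means over circles *)

Section circle_inequalities.
Variable R : realType.
Implicit Types (g : R[i] -> R[i]) (z w c : R[i]) (r s t : R).

Lemma pcont_real : pcont (fun t : R => t%:C).
Proof. by apply: pcont_complex; [exact: continuous_idR|exact: continuous_cst]. Qed.

Lemma pcont_orbit g z : holo g -> pcont (fun t => g (z * cis t)).
Proof.
by move=> hg; apply: pcont_holo => //; apply: pcontM; [exact: pcont_cst|exact: pcont_cis].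
Qed.

Lemma pcont_ray g z : holo g -> pcont (fun t : R => g (t%:C * z)).
Proof.
by move=> hg; apply: pcont_holo => //; apply: pcontM; [exact: pcont_real|exact: pcont_cst].
Qed.

Lemma continuous_sqr (u : R -> R) : continuous u -> continuous (fun t => u t ^+ 2).
Proof. by move=> cu t; rewrite /continuous_at; apply: cvgM; exact: cu. Qed.

Lemma continuous_cabs2 (u : R -> R[i]) : pcont u -> continuous (fun t => cabs (u t) ^+ 2).
Proof. by move=> cu; apply: continuous_sqr; exact: continuous_cabs. Qed.

Lemma circ_ge0 (u : R -> R) : (forall t, 0 <= u t) -> 0 <= circ u.
Proof. by move=> u0; apply: Rintegral_ge0 => t _. Qed.

Lemma mean_value_orbit g z : holo g ->
  circ (fun t => Re (g (z * cis t))) = (pi *+ 2) * Re (g 0).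
Proof.
move=> hg; have := @mean_value _ (fun w => g (z * w)).
rewrite mulr0; apply; apply: holo_comp hg _.
by apply: holoM (holo_cst _) (@holo_id R).
Qed.

(** Rotating g so that g 0 is nonnegative, the mean value property bounds it by
    the mean of the modulus. *)
Lemma mean_cabs_ge g z : holo g ->
  (pi *+ 2) * cabs (g 0) <= circ (fun t => cabs (g (z * cis t))).
Proof.
move=> hg; have [c c1 cg] := unimodular_rotation (g 0).
have hcg : holo (fun w => c * g w) by apply: holoM (holo_cst _) hg.
have <- : Re (c * g 0) = cabs (g 0) by rewrite cg.
rewrite -(mean_value_orbit z hcg).
apply: le_sint; first exact: continuous_Re (pcont_orbit z hcg).
  exact: continuous_cabs (pcont_orbit z hg).
move=> t _; apply: le_trans (ler_norm _) (le_trans (le_Re_cabs _) _).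
by rewrite cabsM c1 mul1r.
Qed.

(** Pythagoras: a holomorphic function minus its value at the centre is
    orthogonal to the constants on every circle. *)
Lemma mean_square_decomp g z : holo g ->
  circ (fun t => cabs (g (z * cis t)) ^+ 2) = (pi *+ 2) * cabs (g 0) ^+ 2 +
  circ (fun t => cabs (g (z * cis t) - g 0) ^+ 2).
Proof.
move=> hg.
have hd : holo (fun w => g w - g 0) by exact: holoB_cst.
pose q w := 2%:C * conjc (g 0) * (g w - g 0).
have hq : holo q by apply: holoM (holo_cst _) hd.
have cq := continuous_Re (pcont_orbit z hq).
have cd := continuous_cabs2 (pcont_orbit z hd).
have ck := @continuous_cst R (cabs (g 0) ^+ 2).
have q0 : circ (fun t => Re (q (z * cis t))) = 0.
  by rewrite mean_value_orbit// /q subrr mulr0 mulr0.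
have -> : (fun t => cabs (g (z * cis t)) ^+ 2) = fun t =>
    cabs (g 0) ^+ 2 + Re (q (z * cis t)) + cabs (g (z * cis t) - g 0) ^+ 2.
  apply/funext => t; rewrite /q; case: (g 0) (g (z * cis t)) => [a b] [c d].
  by rewrite !cabs2 /=; ring.
rewrite /circ sintD//; last by move=> t; apply: cvgD; [exact: ck|exact: cq].
rewrite sintD// -!/(circ _) q0 addr0; congr (_ + _).
exact: circ_cst.
Qed.

(** The holomorphic function of w pairing g (e^w) with the reflected value
    conj (g (s^2 e^(- conj w))) restricts to |g|^2 on the circle of radius s; its
    mean is the same on the circle of radius r. *)
Let pairing g r s : holo g -> 0 < s -> s <= r ->
  circ (fun t => cabs (g (s%:C * cis t)) ^+ 2) =
  circ (fun t => Re (g (r%:C * cis t) * conjc (g ((s ^+ 2 / r)%:C * cis t)))).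
Proof.
move=> hg s0 sr; have r0 := lt_le_trans s0 sr.
have [h [hh hp hE]] : exists h, [/\ holo h,
    forall w, h (w + 0 +i* (pi *+ 2)) = h w &
    forall x t, 0 < x -> h (ln x +i* t) =
      g (x%:C * cis t) * conjc (g ((s ^+ 2 / x)%:C * cis t))].
  exists (fun w => g (cexp w) * conjc (g ((s ^+ 2)%:C * conjc (cexp (- w))))).
  split=> [|w|x t x0].
  - apply: holoM; first by apply: holo_comp hg (@holo_cexp R).
    apply: (@holo_comp _ (fun v => conjc (g ((s ^+ 2)%:C * conjc v)))).
      apply: (@holo_reflect _ (fun v => g ((s ^+ 2)%:C * v))).
      by apply: holo_comp hg _; apply: holoM (holo_cst _) (@holo_id R).
    by apply: holo_comp (@holo_cexp R) (@holo_opp R).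
  - by rewrite cexp_period !cexpN cexp_period.
  - rewrite /cexp /= lnK// expRN lnK// rmorphM /=.
    congr (_ * conjc (g _)).
    by rewrite /cis cosN sinN; simpc; apply/eqP; rewrite eq_complex /= !mulrA !eqxx.
have lsr : ln s <= ln r by rewrite ler_ln.
transitivity (circ (fun t => Re (h (ln s +i* t)))).
  apply: eq_sint => t; rewrite (hE _ _ s0) -Re_mul_conj.
  by rewrite [s ^+ 2]expr2 mulfK// lt0r_neq0.
rewrite -(periodic_mean_const hh hp lsr).
by apply: eq_sint => t; rewrite (hE _ _ r0).
Qed.

Let bounded_disc g r : holo g -> exists M, forall s t, 0 <= s <= r ->
  0 <= t <= pi *+ 2 -> cabs (g (s%:C * cis t)) <= M.
Proof.
move=> hg.
have cg : continuous (fun p : R * R => cabs (g (p.1%:C * cis p.2))).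
  apply: continuous_cabs; apply: pcont_holo => //; apply: pcontM.
    by apply: pcont_complex => p; [exact: cvg_fst|exact: cvg_cst].
  apply: pcont_complex => p; apply: continuous_comp; try exact: cvg_snd.
    exact: continuous_cos.
  exact: continuous_sin.
have K := compact_setX (@segment_compact R 0 r) (@segment_compact R 0 (pi *+ 2)).
have /compact_bounded := continuous_compact (continuous_subspaceT cg) K.
move=> [M [_ hM]]; exists (M + 1) => s t s0 t0.
have M1 : M < M + 1 by rewrite ltrDl.
rewrite -[leLHS]ger0_norm ?cabs_ge0//; apply: (hM _ M1).
by exists (s, t) => //; split; rewrite /= in_itv.
Qed.

(** Hardy's theorem for square means: pairing the circles of radii a and b
    gives a number depending on a * b only, so the square mean N satisfies
    N(s) <= (N(r) + N(s^2 / r)) / 2; as N is bounded on the disc, iterating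
    this inequality leaves N(s) <= N(r). *)
Lemma mean_square_mono g r s : holo g -> 0 < s -> s <= r ->
  circ (fun t => cabs (g (s%:C * cis t)) ^+ 2) <=
  circ (fun t => cabs (g (r%:C * cis t)) ^+ 2).
Proof.
move=> hg s0 sr; have r0 := lt_le_trans s0 sr.
pose N x := circ (fun t => cabs (g (x%:C * cis t)) ^+ 2).
have cN x := continuous_cabs2 (pcont_orbit x%:C hg).
have half x : 0 < x -> x <= r -> N x <= (N r + N (x ^+ 2 / r)) / 2.
  move=> x0 xr.
  have cNN : continuous (fun t => cabs (g (r%:C * cis t)) ^+ 2 +
      cabs (g ((x ^+ 2 / r)%:C * cis t)) ^+ 2).
    by move=> t; apply: cvgD; exact: cN.
  have -> : (N r + N (x ^+ 2 / r)) / 2 = circ (fun t => 2^-1 *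
      (cabs (g (r%:C * cis t)) ^+ 2 + cabs (g ((x ^+ 2 / r)%:C * cis t)) ^+ 2)).
    by rewrite /circ sintZ// sintD// mulrC.
  rewrite /N (pairing hg x0 xr).
  apply: le_sint.
  - apply: continuous_Re; apply: pcontM; first exact: pcont_orbit.
    exact: pcont_conj (pcont_orbit _ hg).
  - by move=> t; apply: cvgM; [apply: cvg_cst|exact: cNN].
  - move=> t _; rewrite Re_mul !cabs2; case: (g _) (g _) => [a b] [c d] /=.
    by have := sqr_ge0 (a - c); have := sqr_ge0 (b - d); nra.
have [M hM] := bounded_disc r hg.
have NM x : 0 < x -> x <= r -> N x - N r <= (pi *+ 2) * M ^+ 2.
  move=> x0 xr; rewrite lerBlDr ler_wpDr//.
    by apply: circ_ge0 => t; exact: sqr_ge0.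
  apply: circ_le => // t t0; have := hM x t; rewrite (ltW x0) xr => /(_ isT t0) h.
  by rewrite ler_pXn2r// ?nnegrE ?cabs_ge0// (le_trans (cabs_ge0 _) h).
have key j : forall x, 0 < x -> x <= r -> N x - N r <= (pi *+ 2) * M ^+ 2 / 2 ^+ j.
  elim: j => [|j IH] x x0 xr; first by rewrite expr0 divr1 NM.
  have x1 : 0 < x ^+ 2 / r by rewrite divr_gt0 ?exprn_gt0.
  have x1r : x ^+ 2 / r <= r by rewrite ler_pdivrMr// expr2; apply: ler_pM => //; exact: ltW.
  have -> : (pi *+ 2) * M ^+ 2 / 2 ^+ j.+1 = (pi *+ 2) * M ^+ 2 / 2 ^+ j / 2.
    by rewrite [2 ^+ j.+1]exprSr invfM mulrA.
  by have := IH _ x1 x1r; have := half x x0 xr; lra.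
rewrite -subr_le0; apply/ler_addgt0Pr => e e0; rewrite add0r.
set B := (pi *+ 2) * M ^+ 2 in NM key.
have B0 : 0 <= B by rewrite mulr_ge0 ?tau_ge0 ?sqr_ge0.
pose n := (Num.truncn (B / e)).+1.
apply: le_trans (key n s s0 sr) _.
rewrite ler_pdivrMr ?exprn_gt0// mulrC -ler_pdivrMr//.
apply: (@le_trans _ _ n%:R); first by rewrite ltW// truncnS_gt.
by rewrite -natrX ler_nat ltnW// ltn_expl.
Qed.

Variables (f F : R[i] -> R[i]).
Hypothesis dF : forall z, cdiff f z (F z).

(** Fundamental theorem of calculus along the ray through z, followed by the
    Cauchy-Schwarz inequality on [0, 1]. *)
Lemma increment_square_le z :
  cabs (f z - f 0) ^+ 2 <= cabs z ^+ 2 * sint 0 1 (fun t => cabs (F (t%:C * z)) ^+ 2).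
Proof.
have hF := derivative_holo dF.
have cF := continuous_cabs (pcont_ray z hF).
have cF2 := continuous_sqr cF.
set m := sint 0 1 (fun t => cabs (F (t%:C * z))).
have le1 : cabs (f z - f 0) <= cabs z * m.
  apply: cabs_le_Re => c c1.
  pose G t := Re (c * f (0 + t%:C * z)).
  have cG : pcont (fun t : R => c * (F (t%:C * z) * z)).
    by apply: pcontM; [exact: pcont_cst|apply: pcontM; [exact: pcont_ray|exact: pcont_cst]].
  have -> : Re (c * (f z - f 0)) = G 1 - G 0.
    by rewrite /G mul1r mul0r !add0r mulrBr Re_sub.
  have dG (t : R) : is_derive t 1 G (Re (c * (F (t%:C * z) * z))).
    have dFt : cdiff f (0 + t%:C * z) (F (t%:C * z)).
      by rewrite add0r; exact: dF.
    exact: is_derive_line dFt.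
  rewrite -(sint_FTC (continuous_Re cG) ler01 dG).
  rewrite -sintZ//; apply: le_sint.
  - exact: continuous_Re cG.
  - by move=> t; apply: cvgM; [apply: cvg_cst|exact: cF].
  - move=> t _; apply: le_trans (ler_norm _) (le_trans (le_Re_cabs _) _).
    by rewrite !cabsM c1 mul1r mulrC.
have m0 : 0 <= m.
  have <- : sint 0 1 (fun=> 0 : R) = 0 by rewrite sint_cst ?ler01// mul0r.
  apply: le_sint => //; first exact: continuous_cst.
  by move=> t _; exact: cabs_ge0.
apply: (@le_trans _ _ ((cabs z * m) ^+ 2)).
  by rewrite ler_pXn2r// nnegrE ?mulr_ge0 ?cabs_ge0.
(* m^2 <= int q^2 follows by integrating 2 m q - m^2 <= q^2 *)
rewrite exprMn ler_wpM2l ?sqr_ge0// -subr_ge0.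
have cs : continuous (fun t => 2 * m * cabs (F (t%:C * z)) - m ^+ 2).
  move=> t; apply: cvgB; last by apply: cvg_cst.
  by apply: cvgM; [apply: cvg_cst|exact: cF].
have := @le_sint _ 0 1 _ _ cs cF2.
rewrite sintB; [|by move=> t; apply: cvgM; [apply: cvg_cst|exact: cF]|exact: continuous_cst].
rewrite sintZ// sint_cst ?ler01// -/m subr0 mulr1.
have hx t : 2 * m * cabs (F (t%:C * z)) - m ^+ 2 <= cabs (F (t%:C * z)) ^+ 2.
  by have := sqr_ge0 (cabs (F (t%:C * z)) - m); nra.
by move=> /(_ (fun t _ => hx t)); rewrite expr2; lra.
Qed.

End circle_inequalities.

(** * Lebesgue measure on the plane *)

Section area_measure.
Variable R : realType.

(** Naming the planar measure lets it carry the sigma-finite structure that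
    Tonelli's theorem with a third real variable needs. *)
Definition area : set (measurableTypeR R * measurableTypeR R)%type -> \bar R :=
  (@lebesgue_measure R \x @lebesgue_measure R)%E.

HB.instance Definition _ := Measure.on area.

Let area_sigma_finite : sigma_finite setT area.
Proof.
pose I (n : nat) : set R := `[- n%:R, n%:R].
exists (fun n : nat => I n `*` I n).
  rewrite predeqE => -[x y]; split => // _.
  pose n := (Num.truncn (Num.max `|x| `|y|)).+1.
  have : Num.max `|x| `|y| < n%:R by exact: truncnS_gt.
  rewrite gt_max => /andP[xn yn]; exists n => //.
  by split; rewrite /I /= in_itv /= -ler_norml ltW.
have mI n : measurable (I n) by exact: measurable_itv.
move=> n; split; first by apply: measurableX; exact: mI.
have vI : (@lebesgue_measure R (I n) < +oo)%E.
  by rewrite /I lebesgue_measure_itv /=; case: ifP => // _; rewrite ltry.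
rewrite /area product_measure1E; [|exact: mI..].
by apply: lte_mul_pinfty => //; rewrite ge0_fin_numE.
Qed.

HB.instance Definition _ :=
  @Measure_isSigmaFinite.Build _ _ _ area area_sigma_finite.

Lemma area_integralE (g : R[i] -> \bar R) :
  area_integral g = (\int[area]_p g (p.1 +i* p.2))%E.
Proof. by []. Qed.

(** An open set of the plane is a countable union of rational boxes. *)
Lemma open_measurable_prod (U : set (R * R)) : open U -> measurable U.
Proof.
move=> oU.
pose box (a b c d : rat) : set (R * R) :=
  (`]ratr a, ratr b[ : set R) `*` (`]ratr c, ratr d[ : set R).
pose B a b c d := if pselect (box a b c d `<=` U) then box a b c d else set0.
have -> : U = \bigcup_a \bigcup_b \bigcup_c \bigcup_d B a b c d.
  apply/seteqP; split => [[x y] Uxy|p [a _ [b _ [c _ [d _]]]]]; last first.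
    by rewrite /B; case: pselect => // h /h.
  have [[V W] /= [Vx Wy] VW] : nbhs (x, y) U by apply: open_nbhs_nbhs; split.
  have /nbhs_ballP[e1 /= e10 b1] := Vx; have /nbhs_ballP[e2 /= e20 b2] := Wy.
  have [a ha] := @rat_in_itvoo R (x - e1) x ltac:(by rewrite ltrBlDr ltrDl).
  have [b hb] := @rat_in_itvoo R x (x + e1) ltac:(by rewrite ltrDl).
  have [c hc] := @rat_in_itvoo R (y - e2) y ltac:(by rewrite ltrBlDr ltrDl).
  have [d hd] := @rat_in_itvoo R y (y + e2) ltac:(by rewrite ltrDl).
  exists a => //; exists b => //; exists c => //; exists d => //.
  move: ha hb hc hd; rewrite !in_itv /= => /andP[a1 a2] /andP[b3 b4] /andP[c1 c2] /andP[d1 d2].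
  rewrite /B; case: pselect => [sb|nb].
    by split; rewrite /= in_itv /= ?a2 ?c2.
  exfalso; apply: nb => p bp; have [] := bp.
  rewrite /= !in_itv /= => /andP[u1 u2] /andP[v1 v2].
  apply: VW; split.
  - by apply: b1; rewrite /ball /= ltr_norml; apply/andP; split; lra.
  - by apply: b2; rewrite /ball /= ltr_norml; apply/andP; split; lra.
do 4 (apply: bigcupT_measurable_rat => ?).
rewrite /B; case: pselect => sb; last exact: measurable0.
by apply: measurableX; exact: measurable_itv.
Qed.

Lemma continuous_measurable_prod (u : R * R -> R) :
  continuous u -> measurable_fun [set: R * R] u.
Proof.
move=> cu; apply: (measurability _ (RGenOpens.measurableE R)) => _ [_ [a [b ->]] <-].
rewrite setTI; apply: open_measurable_prod.
by move/continuousP: cu; apply; exact: interval_open.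
Qed.

Local Notation leb := (@lebesgue_measure R).

(** The image of Lebesgue measure under the affine map, multiplied by a, agrees
    with Lebesgue measure on half-open intervals, hence everywhere. *)
Lemma integral_affine (a b : R) (G : R -> \bar R) : 0 < a ->
  measurable_fun [set: R] G -> (forall x, 0 <= G x)%E ->
  (\int[leb]_x G x = a%:E * \int[leb]_x G (a * x + b)%R)%E.
Proof.
move=> a0 mG G0.
have a0' : 0 <= a by exact: ltW.
pose phi (x : measurableTypeR R) : measurableTypeR R := (a * x + b : R).
have mphi : measurable_fun [set: measurableTypeR R] phi.
  by apply: measurable_funD => //; apply: measurable_funM.
have mG' : measurable_fun [set: measurableTypeR R] G by [].
have <- := @ge0_integral_pushforward _ _ _ _ R phi mphi leb setT G measurableT mG'
  (fun x _ => G0 x).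
rewrite -[a%:E]/((NngNum a0')%:num%:E).
rewrite -(ge0_integral_mscale _ measurableT (NngNum a0') mG' (fun x _ => G0 x)).
apply: eq_measure_integral => A mA _; apply: lebesgue_measure_unique => //.
move=> _ [[u v] _ <-] /=.
rewrite /mscale /= /pushforward.
have -> : phi @^-1` `]u, v] = `](u - b) / a, (v - b) / a].
  apply/seteqP; split => x; rewrite /= !in_itv /phi /= ltr_pdivrMr// ler_pdivlMr//;
    by rewrite ltrBlDr lerBrDr mulrC.
rewrite !lebesgue_measure_itv /= !lte_fin ltr_pM2r ?invr_gt0// ltrD2r.
case: ifP => _; last by rewrite mule0.
by rewrite -!EFinB -EFinM; congr EFin; field; exact: lt0r_neq0.
Qed.

End area_measure.

Section area_invariance.
Variable R : realType.
Local Notation leb := (@lebesgue_measure R).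
Local Notation area := (@area R).
Implicit Types (P : R * R -> \bar R) (a b c d t : R).

Lemma measurable_prod_map (u v : R * R -> R) P :
  continuous u -> continuous v -> measurable_fun [set: R * R] P ->
  measurable_fun [set: R * R] (fun p => P (u p, v p)).
Proof.
move=> /continuous_measurable_prod mu /continuous_measurable_prod mv mP.
by apply: measurableT_comp mP _; exact: measurable_fun_pair.
Qed.

Lemma continuous_affine_prod a c d :
  continuous (fun p : R * R => a * p.1 + c * p.2 + d).
Proof.
move=> p; apply: cvgD; last by apply: cvg_cst.
by apply: cvgD; apply: cvgM; [apply: cvg_cst|exact: cvg_fst|apply: cvg_cst|exact: cvg_snd].
Qed.

Lemma continuous_fstR : continuous (fun p : R * R => p.1).
Proof. by move=> p; exact: cvg_fst. Qed.
Lemma continuous_sndR : continuous (fun p : R * R => p.2).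
Proof. by move=> p; exact: cvg_snd. Qed.

(** Triangular maps change the area by a constant factor: Tonelli's theorem
    reduces this to an affine change of one variable. All the invariance
    properties below are compositions of such maps. *)
Lemma area_affine_fst a c d P : 0 < a -> measurable_fun [set: R * R] P ->
  (forall p, 0 <= P p)%E ->
  (\int[area]_p P p = a%:E * \int[area]_p P (a * p.1 + c * p.2 + d, p.2)%R)%E.
Proof.
move=> a0 mP P0.
have mQ := measurable_prod_map (@continuous_affine_prod a c d) continuous_sndR mP.
rewrite -(@ge0_integralZl_EFin _ _ _ area _ measurableT _ (fun p _ => P0 _) mQ a (ltW a0)).
rewrite (@fubini_tonelli2 _ _ _ _ R leb leb P mP P0).
rewrite (@fubini_tonelli2 _ _ _ _ R leb leb _ _ _); last 2 first.
- by apply: measurable_funeM.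
- by move=> p; apply: mule_ge0; [rewrite lee_fin ltW|exact: P0].
apply: eq_integral => y _; rewrite /fubini_G /=.
have mPy : measurable_fun [set: R] (fun x => P (x, y)) by exact: measurableT_comp.
rewrite (integral_affine (c * y + d) a0 mPy)//.
rewrite ge0_integralZl_EFin ?ltW//.
  by congr (_ * _)%E; apply: eq_integral => x _; rewrite addrA.
have cX : measurable_fun [set: R] (fun x : R => a * x + c * y + d).
  by apply: measurable_funD => //; apply: measurable_funD => //; apply: measurable_funM.
exact: (measurableT_comp mPy cX).
Qed.

Lemma area_affine_snd a c d P : 0 < a -> measurable_fun [set: R * R] P ->
  (forall p, 0 <= P p)%E ->
  (\int[area]_p P p = a%:E * \int[area]_p P (p.1, c * p.1 + a * p.2 + d)%R)%E.
Proof.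
move=> a0 mP P0.
have mQ := measurable_prod_map continuous_fstR (@continuous_affine_prod c a d) mP.
rewrite -(@ge0_integralZl_EFin _ _ _ area _ measurableT _ (fun p _ => P0 _) mQ a (ltW a0)).
rewrite (@fubini_tonelli1 _ _ _ _ R leb leb P mP P0).
rewrite (@fubini_tonelli1 _ _ _ _ R leb leb _ _ _); last 2 first.
- by apply: measurable_funeM.
- by move=> p; apply: mule_ge0; [rewrite lee_fin ltW|exact: P0].
apply: eq_integral => x _; rewrite /fubini_F /=.
have mPx : measurable_fun [set: R] (fun y => P (x, y)) by exact: measurableT_comp.
rewrite (integral_affine (c * x + d) a0 mPx)//.
rewrite ge0_integralZl_EFin ?ltW//.
  by congr (_ * _)%E; apply: eq_integral => y _; rewrite addrA [a * _ + _]addrC.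
have cX : measurable_fun [set: R] (fun y : R => c * x + a * y + d).
  by apply: measurable_funD => //; apply: measurable_funD => //; apply: measurable_funM.
exact: (measurableT_comp mPx cX).
Qed.

Implicit Types (G : R[i] -> \bar R) (z w : R[i]).

(** Measurability as a function of the two real coordinates. *)
Definition carea_measurable G := measurable_fun [set: R * R] (fun p => G (p.1 +i* p.2)).

Lemma carea_measurable_affine G z w : carea_measurable G ->
  carea_measurable (fun v => G (z * v + w)).
Proof.
case: z w => [a b] [c d] mG.
have := measurable_prod_map (@continuous_affine_prod a (- b) c)
  (@continuous_affine_prod b a d) mG.
rewrite /carea_measurable; congr measurable_fun; apply/funext => -[x y] /=; congr G.
by apply/eqP; rewrite eq_complex /= mulNr eqxx /= [b * _ + _]addrC eqxx.
Qed.

Lemma area_translation G w : carea_measurable G -> (forall z, 0 <= G z)%E ->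
  area_integral (fun z => G (z + w)) = area_integral G.
Proof.
case: w => c d mG G0; rewrite !area_integralE.
rewrite [RHS](@area_affine_fst 1 0 c)// mul1e.
rewrite [RHS](@area_affine_snd 1 0 d) ?ltr01//; last first.
  exact: (measurable_prod_map (@continuous_affine_prod 1 0 c) continuous_sndR mG).
by rewrite mul1e; apply: eq_integral => -[x y] _ /=; rewrite !mul0r !mul1r addr0 add0r.
Qed.

Lemma area_scaling G t : 0 < t -> carea_measurable G -> (forall z, 0 <= G z)%E ->
  area_integral G = ((t ^+ 2)%:E * area_integral (fun z => G (t%:C * z)%R))%E.
Proof.
move=> t0 mG G0; rewrite !area_integralE.
rewrite [LHS](@area_affine_fst t 0 0)//.
rewrite [X in (_ * X = _)%E](@area_affine_snd t 0 0)//; last first.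
  exact: (measurable_prod_map (@continuous_affine_prod t 0 0) continuous_sndR mG).
rewrite muleA -EFinM -expr2; congr (_ * _)%E; apply: eq_integral => -[x y] _ /=.
by congr G; apply/eqP; rewrite eq_complex /=; apply/andP; split; apply/eqP; ring.
Qed.

(** A rotation by an acute angle is the product of two triangular maps of
    determinants cos t and 1 / cos t. *)
Let area_rotation_acute G t : 0 < cos t -> carea_measurable G ->
  (forall z, 0 <= G z)%E ->
  area_integral (fun z => G (cis t * z)) = area_integral G.
Proof.
move=> t0 mG G0; rewrite !area_integralE.
have t1 : 0 < (cos t)^-1 by rewrite invr_gt0.
rewrite [RHS](@area_affine_snd (cos t)^-1 (sin t / cos t) 0)//.
rewrite [X in (_ = _ * X)%E](@area_affine_fst (cos t) (- sin t) 0)//; last first.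
  exact: (measurable_prod_map continuous_fstR (@continuous_affine_prod _ _ 0) mG).
rewrite muleA -EFinM mulVf ?lt0r_neq0// mul1e; apply: eq_integral => -[x y] _ /=.
rewrite !addr0 mulNr; congr (G (_ +i* _)).
have e : sin t ^+ 2 = 1 - cos t ^+ 2 by rewrite -(cos2Dsin2 t); ring.
have -> : sin t / cos t * (cos t * x - sin t * y) + (cos t)^-1 * y =
  sin t * x + (1 - sin t ^+ 2) / cos t * y by field; exact: lt0r_neq0.
by rewrite e opprB subrKC expr2 mulfK ?lt0r_neq0// addrC.
Qed.

Let area_rotation_double G t :
  (forall G, carea_measurable G -> (forall z, 0 <= G z)%E ->
    area_integral (fun z => G (cis t * z)) = area_integral G) ->
  carea_measurable G -> (forall z, 0 <= G z)%E ->
  area_integral (fun z => G (cis (t *+ 2) * z)) = area_integral G.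
Proof.
move=> H mG G0; rewrite -(H G)// -(H (fun z => G (cis t * z)))//.
  by congr area_integral; apply/funext => z; rewrite mulr2n cisD mulrA.
have := carea_measurable_affine (cis t) 0 mG.
by congr carea_measurable; apply/funext => z; rewrite addr0.
Qed.

(** Any angle of the interval is eight times an acute one. *)
Lemma area_rotation G t : 0 <= t <= pi *+ 2 -> carea_measurable G ->
  (forall z, 0 <= G z)%E ->
  area_integral (fun z => G (z * cis t)) = area_integral G.
Proof.
move=> /andP[t0 t1] mG G0.
have -> : (fun z => G (z * cis t)) = (fun z => G (cis (t / 8 *+ 2 *+ 2 *+ 2) * z)).
  apply/funext => z; rewrite mulrC; congr (G (cis _ * _)).
  by rewrite !mulr2n; field.
apply: area_rotation_double => //; clear G mG G0 => G mG G0.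
apply: area_rotation_double => //; clear G mG G0 => G mG G0.
apply: area_rotation_double => //; clear G mG G0 => G mG G0.
apply: area_rotation_acute => //; apply: cos_gt0_pihalf.
by have := pi_gt0 R; move: t1; rewrite mulr2n; move: (pi : R) => q *; apply/andP; split; lra.
Qed.

End area_invariance.

(** * Averages over rotations *)

Section averages.
Variable R : realType.
Local Notation leb := (@lebesgue_measure R).
Local Notation area := (@area R).
Local Notation plane := (R * R)%type.

Section segment_area_tonelli.
Variables (D : set R) (H : R * plane -> \bar R).
Hypotheses (mD : measurable D) (mH : measurable_fun [set: R * plane] H).
Hypothesis H0 : forall q, (0 <= H q)%E.

Let H' (q : R * plane) : \bar R := (H q * (\1_D q.1)%:E)%E.

Let mH' : measurable_fun [set: R * plane] H'.
Proof.
apply: emeasurable_funM => //; apply/measurable_EFinP.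
by apply: measurableT_comp => //; exact: measurable_indic.
Qed.

Let H'0 q : (0 <= H' q)%E.
Proof. by rewrite mule_ge0// lee_fin. Qed.

Let H'E p : (\int[leb]_(t in D) H (t, p) = \int[leb]_t H' (t, p))%E.
Proof. by rewrite integral_mkcond epatch_indic. Qed.

Lemma measurable_segment_integral :
  measurable_fun [set: plane] (fun p => \int[leb]_(t in D) H (t, p))%E.
Proof.
under eq_fun do rewrite H'E.
exact: (@measurable_fun_fubini_tonelli_G _ _ _ _ R leb H' mH' H'0).
Qed.

Lemma area_segment_tonelli :
  (\int[area]_p \int[leb]_(t in D) H (t, p) =
   \int[leb]_(t in D) \int[area]_p H (t, p))%E.
Proof.
under eq_integral do rewrite H'E.
rewrite -(@fubini_tonelli _ _ _ _ R leb area H' mH' H'0).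
rewrite [RHS]integral_mkcond epatch_indic; apply: eq_integral => t _ /=.
rewrite /H' /= muleC -ge0_integralZl_EFin//.
- by under eq_integral do rewrite muleC.
- by apply: measurableT_comp mH _; exact: measurable_fun_pair.
Qed.

Lemma measurable_area_section :
  measurable_fun [set: R] (fun t => \int[area]_p H (t, p))%E.
Proof. exact: (@measurable_fun_fubini_tonelli_F _ _ _ _ R area H mH H0). Qed.

End segment_area_tonelli.

Implicit Types (G : R[i] -> \bar R) (z w : R[i]).

Let orbit_map G (q : R * plane) : \bar R := G ((q.2.1 +i* q.2.2) * cis q.1).

Let measurable_orbit_map G : carea_measurable G ->
  measurable_fun [set: R * plane] (orbit_map G).
Proof.
move=> mG.
have m1 : measurable_fun [set: R * plane] (fun q => q.2.1).
  exact: measurableT_comp measurable_fst measurable_snd.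
have m2 : measurable_fun [set: R * plane] (fun q => q.2.2).
  exact: measurableT_comp measurable_snd measurable_snd.
have mc : measurable_fun [set: R * plane] (fun q => cos q.1).
  apply: measurableT_comp; last exact: measurable_fst.
  exact: continuous_measurable_fun (@continuous_cos R).
have ms : measurable_fun [set: R * plane] (fun q => sin q.1).
  apply: measurableT_comp; last exact: measurable_fst.
  exact: continuous_measurable_fun (@continuous_sin R).
have mphi : measurable_fun [set: R * plane] (fun q : R * plane =>
    (q.2.1 * cos q.1 - q.2.2 * sin q.1, q.2.1 * sin q.1 + q.2.2 * cos q.1)).
  by apply: measurable_fun_pair; [apply: measurable_funB|apply: measurable_funD];
    exact: measurable_funM.
exact: (measurableT_comp mG mphi).
Qed.

Definition circle_integral G z : \bar R :=
  (\int[leb]_(t in `[0%R, (pi *+ 2)%R]) G (z * cis t)%R)%E.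

Lemma measurable_circle_integral G : carea_measurable G -> (forall z, 0 <= G z)%E ->
  carea_measurable (circle_integral G).
Proof.
move=> mG G0; apply: (measurable_segment_integral (H := orbit_map G)) => //.
  exact: measurable_orbit_map.
by move=> q; exact: G0.
Qed.

(** Averaging over rotations: by rotation invariance, integrating over the
    plane the integral along the circle through z multiplies by 2 pi. This
    replaces polar coordinates. *)
Lemma area_circle_average G : carea_measurable G -> (forall z, 0 <= G z)%E ->
  ((pi *+ 2)%:E * area_integral G = area_integral (circle_integral G))%E.
Proof.
move=> mG G0; have mH := measurable_orbit_map mG.
rewrite -[RHS]/(\int[area]_p \int[leb]_(t in `[0%R, (pi *+ 2)%R]) orbit_map G (t, p))%E.
rewrite area_segment_tonelli//; last by move=> q; exact: G0.
transitivity (\int[leb]_(t in `[0%R, (pi *+ 2)%R]) cst (area_integral G) t)%E.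
  rewrite integral_cst//= lebesgue_measure_itv /= lte_fin tau_gt0 -EFinB subr0.
  by rewrite muleC.
apply: eq_integral => t; rewrite inE /= in_itv /= => ht.
exact/esym/area_rotation.
Qed.

Lemma gaussE (x y : R) : gauss (x +i* y) = expR (- ((x ^+ 2 + y ^+ 2) / 2)).
Proof. by rewrite /gauss cabs2. Qed.

Lemma gauss_gt0 z : 0 < gauss z. Proof. exact: expR_gt0. Qed.
Lemma gauss_ge0 z : 0 <= gauss z. Proof. exact: expR_ge0. Qed.

Lemma continuous_gauss (T : topologicalType) (u : T -> R[i]) : pcont u ->
  continuous (fun x => gauss (u x)).
Proof.
move=> cu x; apply: continuous_comp; last exact: continuous_expR.
apply: cvgN; apply: cvgM; last by apply: cvg_cst.
by apply: cvgM; exact: continuous_cabs.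
Qed.

Lemma pcont_plane : pcont (fun p : plane => p.1 +i* p.2).
Proof. by apply: pcont_complex => p; [exact: cvg_fst|exact: cvg_snd]. Qed.

Lemma carea_measurable_continuous (u : R[i] -> R) :
  continuous (fun p : plane => u (p.1 +i* p.2)) ->
  carea_measurable (fun z => (u z)%:E).
Proof. by move=> cu; apply/measurable_EFinP; exact: continuous_measurable_prod. Qed.

Lemma area_gauss2 : area_integral (fun z : R[i] => (gauss z ^+ 2)%:E) = pi%:E.
Proof.
have cg : continuous (fun p : plane => gauss (p.1 +i* p.2) ^+ 2).
  by move=> p; apply: cvgM; exact: continuous_gauss pcont_plane p.
have mg := carea_measurable_continuous (u := fun z => gauss z ^+ 2) cg.
rewrite area_integralE (@fubini_tonelli1 _ _ _ _ R leb leb _ mg); last first.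
  by move=> p; rewrite lee_fin sqr_ge0.
have mG : measurable_fun [set: R] (fun x : R => (gauss_fun x)%:E).
  by apply/measurable_EFinP; exact: measurable_gauss_fun.
have G0 (x : R) : (0 <= (gauss_fun x)%:E)%E by rewrite lee_fin gauss_fun_ge0.
transitivity (\int[leb]_x ((Num.sqrt pi)%:E * (gauss_fun x)%:E))%E; last first.
  rewrite ge0_integralZl_EFin ?sqrtr_ge0// integralT_gauss -EFinM -expr2.
  by rewrite sqr_sqrtr// pi_ge0.
apply: eq_integral => x _; rewrite /fubini_F /= muleC -integralT_gauss.
rewrite -ge0_integralZl_EFin//; last exact: gauss_fun_ge0.
apply: eq_integral => y _; rewrite gaussE -EFinM /gauss_fun; congr EFin.
by rewrite -expRM_natl -expRD; congr expR; rewrite mulr_natl; field.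
Qed.

Lemma area_gauss : area_integral (fun z : R[i] => (gauss z)%:E) = (pi *+ 2)%:E.
Proof.
have s0 : 0 < Num.sqrt (2^-1) :> R by rewrite sqrtr_gt0.
have cg : continuous (fun p : plane => gauss (p.1 +i* p.2) ^+ 2).
  by move=> p; apply: cvgM; exact: continuous_gauss pcont_plane p.
have mg := carea_measurable_continuous (u := fun z => gauss z ^+ 2) cg.
have := area_scaling s0 mg (fun z => _).
rewrite area_gauss2 sqr_sqrtr// => E.
have -> : (pi *+ 2)%:E = (2%:E * pi%:E)%E :> \bar R by rewrite -EFinM mulr_natl.
rewrite E; last by move=> z; rewrite lee_fin sqr_ge0.
rewrite muleA -EFinM mulfV// mul1e; congr area_integral; apply/funext => z.
congr EFin; rewrite /gauss cabsM cabs_real exprMn ger0_norm ?ltW// sqr_sqrtr//.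
by rewrite -expRM_natl; congr expR; field.
Qed.

Lemma continuous_planeM (u v : R[i] -> R) :
  continuous (fun p : plane => u (p.1 +i* p.2)) ->
  continuous (fun p : plane => v (p.1 +i* p.2)) ->
  continuous (fun p : plane => u (p.1 +i* p.2) * v (p.1 +i* p.2)).
Proof. by move=> cu cv p; apply: cvgM; [exact: cu|exact: cv]. Qed.

Lemma le_area G1 G2 : carea_measurable G1 -> carea_measurable G2 ->
  (forall z, 0 <= G1 z)%E -> (forall z, G1 z <= G2 z)%E ->
  (area_integral G1 <= area_integral G2)%E.
Proof. by move=> m1 m2 G0 G12; apply: (ge0_le_integral area). Qed.

Lemma areaZ (k : R) G : 0 <= k -> carea_measurable G -> (forall z, 0 <= G z)%E ->
  area_integral (fun z => k%:E * G z)%E = (k%:E * area_integral G)%E.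
Proof. by move=> k0 mG G0; apply: (ge0_integralZl_EFin area). Qed.

Lemma areaD G1 G2 : carea_measurable G1 -> carea_measurable G2 ->
  (forall z, 0 <= G1 z)%E -> (forall z, 0 <= G2 z)%E ->
  area_integral (fun z => G1 z + G2 z)%E = (area_integral G1 + area_integral G2)%E.
Proof. by move=> m1 m2 G01 G02; apply: (ge0_integralD area). Qed.

Lemma eq_area G1 G2 : (forall z, G1 z = G2 z) -> area_integral G1 = area_integral G2.
Proof. by move=> h; congr area_integral; apply/funext. Qed.

End averages.

(** * The pointwise bound in the Fock space *)

Section pointwise.
Variable R : realType.
Local Notation leb := (@lebesgue_measure R).
Local Notation plane := (R * R)%type.
Implicit Types (g : R[i] -> R[i]) (z w : R[i]).

Lemma gauss_rot z (t : R) : gauss (z * cis t) = gauss z.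
Proof. by rewrite /gauss cabsM cabs_cis mulr1. Qed.

Lemma continuous_cabs_plane g : holo g ->
  continuous (fun p : plane => cabs (g (p.1 +i* p.2))).
Proof. by move=> hg; apply: continuous_cabs; apply: pcont_holo => //; exact: pcont_plane. Qed.

Lemma continuous_gauss_plane : continuous (fun p : plane => gauss (p.1 +i* p.2)).
Proof. by apply: continuous_gauss; exact: pcont_plane. Qed.

Lemma carea_measurable_l1 g : holo g ->
  carea_measurable (fun z => (cabs (g z) * gauss z)%:E).
Proof.
move=> hg; apply: (carea_measurable_continuous (u := fun z => cabs (g z) * gauss z)).
exact: (continuous_planeM (u := fun z => cabs (g z)) (continuous_cabs_plane hg)
  continuous_gauss_plane).
Qed.

Lemma carea_measurable_l2 g : holo g ->
  carea_measurable (fun z => (cabs (g z) ^+ 2 * gauss z ^+ 2)%:E).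
Proof.
move=> hg.
apply: (carea_measurable_continuous (u := fun z => cabs (g z) ^+ 2 * gauss z ^+ 2)).
have c1 := continuous_cabs_plane hg; have c2 := continuous_gauss_plane.
by apply: (continuous_planeM (u := fun z => cabs (g z) ^+ 2) (v := fun z => gauss z ^+ 2));
  move=> p; apply: cvgM; [exact: c1|exact: c1|exact: c2|exact: c2].
Qed.

(** The pointwise bound in the Fock space F^1: the Weyl translation
    z |-> g (z + w) e^(- conj w z) moves w to the origin isometrically up to
    the constant factor e^(|w|^2 / 2), and at the origin the bound is the mean value
    inequality averaged against the Gaussian. *)
Lemma fock_pointwise g w : holo g ->
  ((pi *+ 2 * (cabs (g w) * gauss w))%:E <=
   area_integral (fun z => (cabs (g z) * gauss z)%:E))%E.
Proof.
move=> hg.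
pose G z := g (z + w) * cexp (- (conjc w * z)).
have hG : holo G.
  apply: holoM.
    by apply: holo_comp hg _; apply: holoD (@holo_id R) (holo_cst _).
  apply: holo_comp (@holo_cexp R) _; apply: holo_comp (@holo_opp R) _.
  by apply: holoM (holo_cst _) (@holo_id R).
have GE z : gauss w * (cabs (G z) * gauss z) = cabs (g (z + w)) * gauss (z + w).
  rewrite /G cabsM cabs_cexp mulrCA -!mulrA; congr (_ * _).
  rewrite /gauss -!expRD; congr expR; rewrite !cabs2.
  by clear hG G; case: z w => [a b] [c d] /=; field.
have G00 : G 0 = g w by rewrite /G add0r mulr0 oppr0 cexp0 mulr1.
have mG := carea_measurable_l1 hG; have mg := carea_measurable_l1 hg.
have P0 (u : R[i] -> R[i]) z : (0 <= (cabs (u z) * gauss z)%:E)%E.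
  by rewrite lee_fin mulr_ge0 ?cabs_ge0 ?gauss_ge0.
rewrite -(area_translation w mg (P0 g)).
under [X in (_ <= X)%E]eq_area => z do rewrite -GE EFinM.
rewrite areaZ ?gauss_ge0//.
have tau0 := tau_gt0 R.
have tw0 : 0 <= pi *+ 2 * cabs (g w) by rewrite mulr_ge0 ?tau_ge0 ?cabs_ge0.
rewrite mulrA mulrC EFinM lee_pmul2l ?lte_fin ?gauss_gt0//.
rewrite -(@lee_pmul2l _ (pi *+ 2)%:E) ?lte_fin// area_circle_average//.
rewrite -[in leLHS]area_gauss muleC -areaZ//; last 2 first.
- exact: carea_measurable_continuous continuous_gauss_plane.
- by move=> z; rewrite lee_fin gauss_ge0.
apply: le_area.
- apply: (carea_measurable_continuous (u := fun z => pi *+ 2 * cabs (g w) * gauss z)).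
  by move=> p; apply: cvgM; [apply: cvg_cst|exact: continuous_gauss_plane].
- by apply: measurable_circle_integral => // z; exact: P0.
- by move=> z; rewrite lee_fin mulr_ge0 ?gauss_ge0.
- move=> z; rewrite /circle_integral.
  under eq_integral do rewrite gauss_rot.
  have cG := continuous_cabs (pcont_orbit z hG).
  rewrite sint_fin; last by move=> t; apply: cvgM; [exact: cG|apply: cvg_cst].
  rewrite lee_fin.
  under eq_sint => t do rewrite mulrC.
  rewrite sintZ// mulrC ler_wpM2l ?gauss_ge0// -G00.
  exact: mean_cabs_ge.
Qed.

End pointwise.

(** * Chebyshev's inequality and the radial kernel *)

Section unit_interval.
Variable R : realType.
Local Notation leb := (@lebesgue_measure R).
Implicit Types (a t : R).

Lemma oc01_measure : leb `]0, 1] = 1%E.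
Proof. by rewrite lebesgue_measure_itv /= lte_fin ltr01 -EFinB subr0. Qed.

(** Chebyshev's inequality between the nondecreasing functions Psi and
    t |-> 2 t, the latter having mean 1: integrate
    (2 t - 1) (Psi t - Psi (1/2)) >= 0. When Psi (1/2) is infinite, so is the
    right-hand side. *)
Lemma chebyshev_unit (Psi : R -> \bar R) : measurable_fun [set: R] Psi ->
  (forall t, 0 <= Psi t)%E ->
  (forall s t : R, 0 < s -> s <= t -> (Psi s <= Psi t)%E) ->
  (\int[leb]_(t in `]0%R, 1%R]) Psi t <=
   \int[leb]_(t in `]0%R, 1%R]) ((2 * t)%:E * Psi t))%E.
Proof.
move=> mPsi Psi0 incr.
have h0 : 0 < 2^-1 :> R by rewrite invr_gt0.
have m2t : measurable_fun [set: R] (fun t => (2 * t)%:E).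
  by apply/measurable_EFinP; apply: measurable_funM.
have m2P : measurable_fun [set: R] (fun t => (2 * t)%:E * Psi t)%E.
  exact: emeasurable_funM.
have restr f : measurable_fun [set: R] f ->
    measurable_fun (`]0, 1] : set R) (f : R -> \bar R).
  by move=> mf; exact: measurable_funS mf.
have t0 t : `]0, 1] t -> 0 < t by rewrite /= in_itv => /andP[].
have P2 t : `]0, 1] t -> (0 <= (2 * t)%:E * Psi t)%E.
  by move=> /t0 tt; rewrite mule_ge0// lee_fin mulr_ge0// ltW.
have [PE|] := eqVneq (Psi 2^-1) +oo%E.
  suff -> : (\int[leb]_(t in `]0%R, 1%R]) ((2 * t)%:E * Psi t) = +oo)%E by rewrite leey.
  apply/eqP; rewrite -leye_eq.
  apply: (@le_trans _ _ (\int[leb]_(t in `[(2^-1)%R, 1%R]) ((2 * t)%:E * Psi t))%E); last first.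
    apply: ge0_subset_integral => //; [exact: restr|].
    by move=> t; rewrite /= !in_itv /= => /andP[ht ->]; rewrite (lt_le_trans h0 ht).
  rewrite (_ : (\int[leb]_(t in _) _)%E = \int[leb]_(t in `[(2^-1)%R, 1%R]) cst +oo%E t)%E.
    rewrite integral_cst//= lebesgue_measure_itv /= lte_fin invf_lt1// ltr1n -EFinB.
    by rewrite gt0_mulye// lte_fin subr_gt0 invf_lt1// ltr1n.
  apply: eq_integral => t; rewrite inE /= in_itv /= => /andP[ht _].
  have tpos := lt_le_trans h0 ht.
  have -> : Psi t = +oo%E by apply/eqP; rewrite -leye_eq -PE incr.
  by rewrite gt0_muley// lte_fin mulr_gt0.
rewrite -ltey => Pfin.
have [c cE] : exists c, Psi 2^-1 = c%:E.
  by exists (fine (Psi 2^-1)); rewrite fineK// ge0_fin_numE.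
have c0 : 0 <= c by rewrite -lee_fin -cE.
have key t : `]0, 1] t -> (Psi t + c%:E * (2 * t)%:E <= (2 * t)%:E * Psi t + c%:E)%E.
  move=> /t0 tt; have [PE|] := eqVneq (Psi t) +oo%E.
    by rewrite PE gt0_muley ?lte_fin ?mulr_gt0// !addye// leey.
  rewrite -ltey => Pt.
  have [x xE] : exists x, Psi t = x%:E.
    by exists (fine (Psi t)); rewrite fineK// ge0_fin_numE.
  rewrite xE -!EFinM -!EFinD lee_fin.
  have [th|th] := leP t 2^-1.
    by have := incr _ _ tt th; rewrite xE cE lee_fin; nra.
  by have := incr _ _ h0 (ltW th); rewrite xE cE lee_fin; nra.
have I2 : (\int[leb]_(t in `]0%R, 1%R]) (2 * t)%:E = 1)%E.
  have cid : continuous (fun t : R => 2 * t).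
    by move=> t; apply: cvgM; [apply: cvg_cst|exact: cvg_id].
  rewrite integral_itv_obnd_cbnd; last by apply/measurable_EFinP; apply: measurable_funM.
  have dsq (t : R) : is_derive t 1 (fun s : R => s ^+ 2) (2 * t).
    by apply: is_derive_eq; rewrite -[t%:A]/(t * 1); ring.
  by rewrite sint_fin// (sint_FTC cid ler01 dsq) expr1n expr0n subr0.
have m2c : measurable_fun [set: R] (fun t => c%:E * (2 * t)%:E)%E.
  exact: emeasurable_funM.
have c2t t : `]0, 1] t -> (0 <= c%:E * (2 * t)%:E)%E.
  by move=> /t0 tt; rewrite -EFinM lee_fin mulr_ge0// mulr_ge0// ltW.
have : (\int[leb]_(t in `]0%R, 1%R]) (Psi t + c%:E * (2 * t)%:E) <=
    \int[leb]_(t in `]0%R, 1%R]) ((2 * t)%:E * Psi t + c%:E))%E.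
  apply: ge0_le_integral => //.
  - by move=> t tt; rewrite adde_ge0// c2t.
  - by apply: restr; exact: emeasurable_funD.
  - by apply: restr; exact: emeasurable_funD.
rewrite ge0_integralD//=; [|exact: restr..].
rewrite ge0_integralD//=; [|exact: restr..].
rewrite ge0_integralZl_EFin//=; last 2 first.
- by move=> t /t0 tt; rewrite lee_fin mulr_ge0// ltW.
- exact: restr.
rewrite I2 mule1 -[X in (_ <= _ + X)%E -> _]/(\int[leb]_(t in `]0%R, 1%R]) cst c%:E t)%E.
by rewrite integral_cst//= oc01_measure mule1 leeD2rE.
Qed.

(** The kernel obtained from exp (- a / t ^ 2) by differentiation in t; the
    inverse of t is written exp (- ln t), which is measurable on the whole line. *)
Let iv t := expR (- ln t).
Definition radial_kernel a t : R := 2 * a * iv t ^+ 3 * expR (- (a * iv t ^+ 2)).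

Lemma radial_kernel_ge0 a t : 0 <= a -> 0 <= radial_kernel a t.
Proof. by move=> a0; rewrite !mulr_ge0 ?exprn_ge0 ?expR_ge0. Qed.

Lemma radial_kernelE a t : 0 < t ->
  radial_kernel a t = 2 * a * t ^- 3 * expR (- (a * t ^- 2)).
Proof. by move=> t0; rewrite /radial_kernel /iv expRN lnK// !exprVn. Qed.

Lemma measurable_radial_kernel :
  measurable_fun [set: R * R] (fun p => radial_kernel p.1 p.2).
Proof.
have mi : measurable_fun [set: R * R] (fun p : R * R => iv p.2).
  by apply: measurableT_comp => //; apply: measurableT_comp => //; exact: measurableT_comp.
apply: measurable_funM.
  apply: measurable_funM; last exact: measurable_funX.
  by apply: measurable_funM.
apply: measurableT_comp => //; apply: measurableT_comp => //.
by apply: measurable_funM => //; exact: measurable_funX.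
Qed.

(** On [e, 1] the integral is e^(-a) - e^(-a / e^2) by the fundamental theorem
    of calculus; let e tend to 0. *)
Lemma integral_radial_kernel a : 0 <= a ->
  (\int[leb]_(t in `]0%R, 1%R]) (radial_kernel a t)%:E <= (expR (- a))%:E)%E.
Proof.
move=> a0.
pose e (n : nat) : R := n.+2%:R^-1.
have e0 n : 0 < e n by rewrite invr_gt0.
have e1 n : e n < 1 by rewrite invf_lt1// ltr1n.
pose F n : set R := `[e n, 1].
have bF : \bigcup_n F n = `]0, 1].
  apply/seteqP; split=> [t [n _]|t]; rewrite /F /= !in_itv /= => /andP[h1 h2].
    by rewrite h2 (lt_le_trans (e0 n) h1).
  exists (Num.truncn t^-1) => //; rewrite /F /= in_itv /= h2 andbT /e.
  rewrite -[leRHS]invrK lef_pV2 ?posrE ?invr_gt0//.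
  by apply: ltW; apply: lt_trans (truncnS_gt _) _; rewrite ltr_nat.
have mk : measurable_fun [set: R] (fun t => (radial_kernel a t)%:E).
  have mp : measurable_fun [set: R] (fun t : R => (a, t)) by exact: measurable_fun_pair.
  by apply/measurable_EFinP; exact: (measurableT_comp measurable_radial_kernel mp).
rewrite -bF.
have ndF : {homo F : n m / (n <= m)%N >-> (n <= m)%O}.
  move=> n m nm; apply/subsetPset => t; rewrite /F /= !in_itv /= => /andP[h1 ->].
  by rewrite andbT (le_trans _ h1)// /e lef_pV2 ?posrE// ler_nat.
have cv : (\int[leb]_(t in F n) (radial_kernel a t)%:E)%E @[n --> \oo] -->
    (\int[leb]_(t in \bigcup_n F n) (radial_kernel a t)%:E)%E.
  apply: ge0_nondecreasing_set_cvg_integral => //.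
  - by move=> n; exact: measurable_itv.
  - by move=> n; exact: measurable_funS mk.
  - by move=> n t _; rewrite lee_fin radial_kernel_ge0.
rewrite -(cvg_lim _ cv)//; apply: lime_le; first by apply/cvg_ex; eexists; exact: cv.
apply: nearW => n.
pose G t := expR (- (a * t ^- 2)).
have dG t : 0 < t -> is_derive t 1 G (2 * a * t ^- 3 * expR (- (a * t ^- 2))).
  move=> tp; have t2 : t ^+ 2 != 0 by rewrite expf_neq0// lt0r_neq0.
  have dsq : is_derive t 1 (fun s : R => s ^+ 2) (2 * t).
    by apply: is_derive_eq; rewrite -[t%:A]/(t * 1); ring.
  have [sq1 sq2] := dsq.
  have dV : is_derive t 1 (fun s : R => s ^- 2) (- (2 * t ^- 3)).
    apply: DeriveDef; first exact: derivableV.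
    rewrite deriveV// sq2 -[_ *: _]/(_ * _); field; exact: lt0r_neq0.
  have dN : is_derive t 1 (fun s : R => - (a * s ^- 2)) (2 * a * t ^- 3).
    apply: is_derive_eq; rewrite -[a *: _]/(a * _); ring.
  have := @is_derive1_comp R expR (fun s => - (a * s ^- 2)) t _ _
    (is_derive_expR (- (a * t ^- 2))) dN.
  by rewrite mulrC.
have cG t : 0 < t -> {for t, continuous G}.
  by move=> tp; apply/differentiable_continuous/derivable1_diffP; have [] := dG t tp.
rewrite (_ : (\int[leb]_(t in F n) _)%E =
  \int[leb]_(t in `[e n, 1%R]) (2 * a * t ^- 3 * expR (- (a * t ^- 2)))%:E)%E; last first.
  apply: eq_integral => t; rewrite inE /= ?in_itv /= => /andP[h _].
  by rewrite radial_kernelE// (lt_le_trans (e0 n) h).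
rewrite (@continuous_FTC2 _ _ G)//.
- by rewrite -EFinB lee_fin /G expr1n invr1 mulr1 lerBlDr lerDl expR_ge0.
- apply: continuous_in_subspaceT => t; rewrite inE /= in_itv /= => /andP[h _].
  have tp := lt_le_trans (e0 n) h; have tn := lt0r_neq0 tp.
  apply: cvgM; last exact: cG.
  apply: cvgM; first by apply: cvg_cst.
  by apply: cvgV; [rewrite expf_neq0|apply: exprn_continuous].
- split.
  + by move=> t; rewrite in_itv /= => /andP[h _]; have [] := dG t (lt_trans (e0 n) h).
  + by apply: cvg_at_right_filter; exact: cG.
  + by apply: cvg_at_left_filter; exact: cG.
- move=> t; rewrite in_itv /= => /andP[h _]; rewrite derive1E.
  by have [] := dG t (lt_trans (e0 n) h).
Qed.

End unit_interval.

(** * The energy inequality *)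

Section energy.
Variable R : realType.
Local Notation leb := (@lebesgue_measure R).
Local Notation area := (@area R).
Local Notation plane := (R * R)%type.
Variables (f F : R[i] -> R[i]).
Hypothesis dF : forall z, cdiff f z (F z).

Let hf : holo f. Proof. by move=> z; exists (F z). Qed.
Let hF : holo F. Proof. exact: derivative_holo dF. Qed.

Let gauss2E (z : R[i]) : gauss z ^+ 2 = expR (- cabs z ^+ 2) :> R.
Proof. by rewrite /gauss -expRM_natl; congr expR; field. Qed.

Let circle_integral_l2 (g : R[i] -> R[i]) (z : R[i]) : holo g ->
  circle_integral (fun z => (cabs (g z) ^+ 2 * gauss z ^+ 2)%:E) z =
  (gauss z ^+ 2 * circ (fun t => cabs (g (z * cis t)) ^+ 2))%:E.
Proof.
move=> hg; have cg := continuous_cabs2 (pcont_orbit z hg).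
rewrite /circ -sintZ// -sint_fin; last by move=> t; apply: cvgM; [apply: cvg_cst|exact: cg].
by apply: eq_integral => t _; rewrite gauss_rot mulrC.
Qed.

(** Pythagoras on every circle, integrated over the plane; the mass of the
    weight e^(-|z|^2) is pi. *)
Lemma area_square_decomp :
  area_integral (fun z => (cabs (f z) ^+ 2 * gauss z ^+ 2)%:E) =
  ((pi * cabs (f 0) ^+ 2)%:E +
   area_integral (fun z => (cabs (f z - f 0) ^+ 2 * gauss z ^+ 2)%:E))%E.
Proof.
have hd : holo (fun z => f z - f 0) by exact: holoB_cst.
have P0 (u : R[i] -> R[i]) z : (0 <= (cabs (u z) ^+ 2 * gauss z ^+ 2)%:E)%E.
  by rewrite lee_fin mulr_ge0 ?sqr_ge0.
have Pd z : (0 <= (cabs (f z - f 0) ^+ 2 * gauss z ^+ 2)%:E)%E.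
  exact: (P0 (fun z => f z - f 0)).
have m1 := carea_measurable_l2 hf; have m2 := carea_measurable_l2 hd.
have tau0 := tau_gt0 R.
have k0 : 0 <= pi *+ 2 * cabs (f 0) ^+ 2 by rewrite mulr_ge0 ?tau_ge0 ?sqr_ge0.
have cg : continuous (fun p : plane => gauss (p.1 +i* p.2) ^+ 2).
  by move=> p; apply: cvgM; exact: continuous_gauss_plane.
have mg := carea_measurable_continuous (u := fun z => gauss z ^+ 2) cg.
have g0 z : (0 <= (gauss z ^+ 2)%:E :> \bar R)%E by rewrite lee_fin sqr_ge0.
have E : ((pi *+ 2)%:E * area_integral (fun z => (cabs (f z) ^+ 2 * gauss z ^+ 2)%:E) =
    (pi *+ 2)%:E * ((pi * cabs (f 0) ^+ 2)%:E +
    area_integral (fun z => (cabs (f z - f 0) ^+ 2 * gauss z ^+ 2)%:E)))%E.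
  have c0 : (0 <= (pi * cabs (f 0) ^+ 2)%:E)%E.
    by rewrite lee_fin mulr_ge0 ?pi_ge0 ?sqr_ge0.
  have d0 : (0 <= area_integral (fun z => (cabs (f z - f 0) ^+ 2 * gauss z ^+ 2)%:E))%E.
    by apply: integral_ge0 => p _; exact: Pd.
  rewrite [RHS]ge0_muleDr//.
  rewrite !area_circle_average//.
  have -> : ((pi *+ 2)%:E * (pi * cabs (f 0) ^+ 2)%:E =
      area_integral (fun z => (pi *+ 2 * cabs (f 0) ^+ 2)%:E * (gauss z ^+ 2)%:E))%E.
    by rewrite areaZ// area_gauss2 -!EFinM; congr EFin; ring.
  rewrite -areaD//.
  - apply: eq_area => z; rewrite circle_integral_l2// (circle_integral_l2 z hd).
    by rewrite mean_square_decomp// -EFinM -EFinD; congr EFin; ring.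
  - by apply: measurable_funeM.
  - exact: measurable_circle_integral.
  - by move=> z; rewrite mule_ge0.
  - by move=> z; apply: integral_ge0 => t _; exact: Pd.
by apply/le_anti/andP; split; rewrite -(@lee_pmul2l _ (pi *+ 2)%:E) ?lte_fin// E.
Qed.

(** The contribution of the dilate z |-> F (t z) to the bound on f - f 0. *)
Let Psi (t : R) : \bar R :=
  area_integral (fun z => (gauss z ^+ 2 * cabs z ^+ 2 * cabs (F (t%:C * z)) ^+ 2)%:E).

Let ray_map (q : R * plane) : \bar R :=
  (gauss (q.2.1 +i* q.2.2) ^+ 2 * cabs (q.2.1 +i* q.2.2) ^+ 2 *
   cabs (F (q.1%:C * (q.2.1 +i* q.2.2))) ^+ 2)%:E.

Let measurable_ray_map : measurable_fun [set: R * plane] ray_map.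
Proof.
have mF : measurable_fun [set: plane] (fun p => cabs (F (p.1 +i* p.2)) ^+ 2).
  apply: measurable_funX; apply: continuous_measurable_prod.
  exact: continuous_cabs_plane.
have mz : measurable_fun [set: plane]
    (fun p => gauss (p.1 +i* p.2) ^+ 2 * cabs (p.1 +i* p.2) ^+ 2).
  apply: measurable_funM; apply: measurable_funX; apply: continuous_measurable_prod.
    exact: continuous_gauss_plane.
  exact: continuous_cabs_plane (@holo_id R).
have m1 : measurable_fun [set: R * plane] (fun q => q.2.1).
  exact: measurableT_comp measurable_fst measurable_snd.
have m2 : measurable_fun [set: R * plane] (fun q => q.2.2).
  exact: measurableT_comp measurable_snd measurable_snd.
have mphi : measurable_fun [set: R * plane] (fun q : R * plane =>
    (q.1 * q.2.1 - 0 * q.2.2, q.1 * q.2.2 + 0 * q.2.1)).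
  by apply: measurable_fun_pair; [apply: measurable_funB|apply: measurable_funD];
    exact: measurable_funM.
apply/measurable_EFinP; apply: measurable_funM.
  exact: (measurableT_comp mz measurable_snd).
exact: (measurableT_comp mF mphi).
Qed.

Let ray_map_ge0 q : (0 <= ray_map q)%E.
Proof. by rewrite /ray_map lee_fin !mulr_ge0 ?gauss_ge0 ?cabs_ge0. Qed.

Let increment_le_Psi :
  (area_integral (fun z => (cabs (f z - f 0) ^+ 2 * gauss z ^+ 2)%:E) <=
   \int[leb]_(t in `]0%R, 1%R]) Psi t)%E.
Proof.
have mD : measurable (`]0, 1] : set R) by exact: measurable_itv.
rewrite -(area_segment_tonelli mD measurable_ray_map ray_map_ge0).
have hd : holo (fun z => f z - f 0) by exact: holoB_cst.
apply: (ge0_le_integral area) => //.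
- by move=> p _; rewrite lee_fin mulr_ge0 ?sqr_ge0.
- exact: carea_measurable_l2 hd.
- exact: measurable_segment_integral mD measurable_ray_map ray_map_ge0.
move=> [x y] _; set z := x +i* y.
have cF := continuous_cabs2 (pcont_ray z hF).
have cF2 : continuous (fun t : R =>
    gauss z ^+ 2 * cabs z ^+ 2 * cabs (F (t%:C * z)) ^+ 2).
  by move=> t; apply: cvgM; [apply: cvg_cst|exact: cF].
rewrite /ray_map /= -/z integral_itv_obnd_cbnd; last first.
  by apply/measurable_EFinP; apply: measurable_funTS; exact: continuous_measurable_fun.
rewrite sint_fin// lee_fin sintZ// mulrC -mulrA ler_wpM2l ?sqr_ge0//.
exact: (increment_square_le dF z).
Qed.

Let measurable_Psi_integrand (r : R) :
  carea_measurable (fun z => (gauss z ^+ 2 * cabs z ^+ 2 * cabs (F (r%:C * z)) ^+ 2)%:E).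
Proof.
have mr : measurable_fun [set: plane] (fun p : plane => (r, p)) by exact: measurable_fun_pair.
exact: (measurableT_comp measurable_ray_map mr).
Qed.

(** Averaging over rotations brings out the square means of F on circles, which
    increase with the radius. *)
Let Psi_mono (s t : R) : 0 < s -> s <= t -> (Psi s <= Psi t)%E.
Proof.
move=> s0 st.
have mP := measurable_Psi_integrand.
have P0 r z : (0 <= (gauss z ^+ 2 * cabs z ^+ 2 * cabs (F (r%:C * z)) ^+ 2)%:E)%E.
  by rewrite lee_fin !mulr_ge0 ?gauss_ge0 ?cabs_ge0.
have cE r z : circle_integral (fun z =>
    (gauss z ^+ 2 * cabs z ^+ 2 * cabs (F (r%:C * z)) ^+ 2)%:E) z =
  (gauss z ^+ 2 * cabs z ^+ 2 * circ (fun t => cabs (F (r%:C * cis t * z)) ^+ 2))%:E.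
  have cF := continuous_cabs2 (pcont_orbit (r%:C * z) hF).
  have -> : circ (fun t => cabs (F (r%:C * cis t * z)) ^+ 2) =
      circ (fun t => cabs (F (r%:C * z * cis t)) ^+ 2).
    by apply: eq_sint => v; rewrite mulrAC.
  rewrite /circ.
  rewrite -sintZ// -sint_fin; last by move=> v; apply: cvgM; [apply: cvg_cst|exact: cF].
  by apply: eq_integral => v _; rewrite gauss_rot cabsM cabs_cis mulr1 mulrA.
have avg r := area_circle_average (mP r) (P0 r).
have tau0 : (0 < (pi *+ 2)%:E :> \bar R)%E by rewrite lte_fin tau_gt0.
rewrite -(lee_pmul2l _ tau0) //.
rewrite /Psi (avg s) (avg t); apply: le_area.
- exact: measurable_circle_integral (mP s) (P0 s).
- exact: measurable_circle_integral (mP t) (P0 t).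
- by move=> z; apply: integral_ge0 => x _; exact: P0.
move=> z; rewrite !cE lee_fin; apply: ler_wpM2l.
  by rewrite !mulr_ge0 ?gauss_ge0 ?cabs_ge0.
have hg : holo (fun w => F (w * z)).
  by apply: holo_comp hF _; apply: holoM (@holo_id R) (holo_cst _).
exact: (mean_square_mono hg s0 st).
Qed.

(** The dilation u = t z. *)
Let Psi_scaled (t : R) : 0 < t ->
  ((2 * t)%:E * Psi t =
   area_integral (fun z => (cabs (F z) ^+ 2 * radial_kernel (cabs z ^+ 2) t)%:E))%E.
Proof.
move=> t0; have ti0 : 0 < t^-1 by rewrite invr_gt0.
have mP := measurable_Psi_integrand t.
have P0 z : (0 <= (gauss z ^+ 2 * cabs z ^+ 2 * cabs (F (t%:C * z)) ^+ 2)%:E)%E.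
  by rewrite lee_fin !mulr_ge0 ?gauss_ge0 ?cabs_ge0.
have mP' : carea_measurable (fun z => (gauss (t^-1%:C * z) ^+ 2 *
    cabs (t^-1%:C * z) ^+ 2 * cabs (F (t%:C * (t^-1%:C * z))) ^+ 2)%:E).
  have := carea_measurable_affine t^-1%:C 0 mP.
  by congr carea_measurable; apply/funext => z; rewrite addr0.
rewrite /Psi (area_scaling ti0 mP P0) muleA -EFinM -areaZ//; last first.
  by rewrite mulr_ge0 ?sqr_ge0// mulr_ge0// ltW.
apply: eq_area => z; rewrite -EFinM radial_kernelE// gauss2E; congr EFin.
have -> : t%:C * (t^-1%:C * z) = z.
  by rewrite mulrA -rmorphM mulfV ?lt0r_neq0// mul1r.
rewrite cabsM cabs_real ger0_norm ?ltW// exprMn exprVn.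
rewrite [t ^- 2 * _]mulrC; move: (expR _) => E.
by field; exact: lt0r_neq0.
Qed.

(** This is the Poincare inequality for the Gaussian weight e^(-|z|^2), as the
    squared gradient of a holomorphic f is 2 |F|^2. *)
Lemma energy_inequality :
  (area_integral (fun z => (cabs (f z - f 0) ^+ 2 * gauss z ^+ 2)%:E) <=
   area_integral (fun z => (cabs (F z) ^+ 2 * gauss z ^+ 2)%:E))%E.
Proof.
apply: le_trans increment_le_Psi _.
have mPsi : measurable_fun [set: R] Psi.
  exact: measurable_area_section measurable_ray_map ray_map_ge0.
have Psi0 t : (0 <= Psi t)%E.
  by apply: integral_ge0 => p _; exact: (ray_map_ge0 (t, p)).
apply: le_trans (chebyshev_unit mPsi Psi0 Psi_mono) _.
have mD : measurable (`]0, 1] : set R) by exact: measurable_itv.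
pose K (q : R * plane) : \bar R := (cabs (F (q.2.1 +i* q.2.2)) ^+ 2 *
  radial_kernel (cabs (q.2.1 +i* q.2.2) ^+ 2) q.1)%:E.
have mK : measurable_fun [set: R * plane] K.
  have mF : measurable_fun [set: plane] (fun p => cabs (F (p.1 +i* p.2)) ^+ 2).
    apply: measurable_funX; apply: continuous_measurable_prod.
    exact: continuous_cabs_plane.
  have ma : measurable_fun [set: plane] (fun p => cabs (p.1 +i* p.2) ^+ 2).
    apply: measurable_funX; apply: continuous_measurable_prod.
    exact: continuous_cabs_plane (@holo_id R).
  have mk : measurable_fun [set: R * plane] (fun q => (cabs (q.2.1 +i* q.2.2) ^+ 2, q.1)).
    by apply: measurable_fun_pair => //; exact: (measurableT_comp ma measurable_snd).
  apply/measurable_EFinP; apply: measurable_funM.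
    exact: (measurableT_comp mF measurable_snd).
  exact: (measurableT_comp (@measurable_radial_kernel R) mk).
have K0 q : (0 <= K q)%E.
  by rewrite lee_fin mulr_ge0 ?sqr_ge0// radial_kernel_ge0 ?sqr_ge0.
rewrite (_ : (\int[leb]_(t in _) _)%E =
    \int[leb]_(t in `]0%R, 1%R]) \int[area]_p K (t, p))%E; last first.
  by apply: eq_integral => t; rewrite inE /= in_itv /= => /andP[t0 _]; rewrite Psi_scaled.
rewrite -area_segment_tonelli//.
apply: (ge0_le_integral area) => //.
- by move=> p _; apply: integral_ge0 => t _; exact: K0.
- exact: measurable_segment_integral mD mK K0.
- exact: carea_measurable_l2 hF.
move=> [x y] _; rewrite /K /=; set z := x +i* y.
under eq_integral do rewrite EFinM.
have a0 : 0 <= cabs z ^+ 2 by exact: sqr_ge0.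
rewrite ge0_integralZl_EFin ?sqr_ge0//; last 2 first.
- by move=> t _; rewrite lee_fin radial_kernel_ge0.
- have mp : measurable_fun [set: R] (fun t : R => (cabs z ^+ 2, t)) by exact: measurable_fun_pair.
  apply: (measurable_funS measurableT) => //.
  by apply/measurable_EFinP; exact: (measurableT_comp (@measurable_radial_kernel R) mp).
rewrite [leRHS]EFinM gauss2E lee_wpmul2l ?lee_fin ?sqr_ge0//.
exact: integral_radial_kernel.
Qed.

End energy.

(** * The embedding and the theorem *)

Section embedding.
Variable R : realType.
Variable g : R[i] -> R[i].
Hypothesis hg : holo g.

(** The pointwise bound is applied to one of the two factors of the square. *)
Lemma fock_embedding :
  (area_integral (fun z => (cabs (g z) ^+ 2 * gauss z ^+ 2)%:E) <=
   ((2 * pi)^-1)%:E * area_integral (fun z => (cabs (g z) * gauss z)%:E) ^+ 2)%E.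
Proof.
set A := area_integral (fun z => (cabs (g z) * gauss z)%:E).
have P0 z : (0 <= (cabs (g z) * gauss z)%:E)%E.
  by rewrite lee_fin mulr_ge0 ?cabs_ge0 ?gauss_ge0.
have A0 : (0 <= A)%E by apply: integral_ge0 => p _; exact: P0.
have p0 : 0 < (2 * pi)^-1 :> R by rewrite invr_gt0 mulr_gt0 ?pi_gt0.
have [->|] := eqVneq A +oo%E.
  by rewrite expe2 mulyy gt0_muley ?lte_fin// leey.
rewrite -ltey => Afin.
have [r rE] : exists r, A = r%:E by exists (fine A); rewrite fineK// ge0_fin_numE.
have r0 : 0 <= r by rewrite -lee_fin -rE.
have bound z : cabs (g z) * gauss z <= (2 * pi)^-1 * r.
  have H := fock_pointwise z hg; rewrite -/A rE lee_fin -mulr_natl in H.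
  by rewrite [leRHS]mulrC ler_pdivlMr ?mulr_gt0 ?pi_gt0// mulrC.
apply: (@le_trans _ _ (((2 * pi)^-1 * r)%:E * A)%E); last first.
  by rewrite rE -EFin_expe -!EFinM lee_fin expr2 mulrA.
have k0 : 0 <= (2 * pi)^-1 * r by rewrite mulr_ge0// ltW.
have mA := carea_measurable_l1 hg.
rewrite -areaZ//; apply: le_area.
- exact: carea_measurable_l2.
- by apply: measurable_funeM.
- by move=> z; rewrite lee_fin mulr_ge0 ?sqr_ge0.
- move=> z; rewrite -EFinM lee_fin -exprMn expr2 ler_wpM2r//.
  by rewrite mulr_ge0 ?cabs_ge0 ?gauss_ge0.
Qed.

End embedding.

Theorem mainTheorem2 (R : realType) (f : R[i] -> R[i])
    (hf : fock_sobolev11 f) :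
  (area_integral (fun z => (cabs (f z * (gauss z)%:C) ^+ 2)%:E)
     - (pi * cabs (f 0) ^+ 2)%:E
   <= ((2 * pi)^-1)%:E
      * area_integral (fun z => (cabs (cderiv f z * (gauss z)%:C))%:E) ^+ 2)%E.
Proof.
have [ef _] := hf; have dF := entire_cdiff ef.
have gE (u z : R[i]) : cabs (u * (gauss z)%:C) = cabs u * gauss z.
  by rewrite cabsM cabs_real ger0_norm ?gauss_ge0.
under [X in (X - _)%E]eq_area => z do rewrite gE exprMn.
under [X in (_ * X ^+ 2)%E]eq_area => z do rewrite gE.
rewrite leeBlDr//; rewrite (area_square_decomp dF) addeC leeD2rE//.
apply: le_trans (energy_inequality dF) _.
exact: fock_embedding (derivative_holo dF).
Qed.
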